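(* Let $\mathbf X$ be a finite dimensional Hilbert space. Assume that $f:\mathbf X\to[-\infty,\infty]$ is prox-regular and subdifferentially continuous at $\bar x$ for $\bar v\in\partial f(\bar x)$ and that $\partial f$ is strictly proto-differentiable at $\bar x$ for $\bar v$. Let $\overline K:=\mathrm{dom}\,\mathrm d^2f(\bar x,\bar v)$ (which is a linear subspace) and let $A:\mathbf X\to\mathbf X$ be a linear symmetric mapping such that $\mathrm d^2f(\bar x,\bar v)(w)=\langle A(w),w\rangle+\delta_{\overline K}(w)$ for all $w\in\mathbf X$ (such an $A$ exists). Then $$D(\partial f)(\bar x,\bar v)(w)=D^*(\partial f)(\bar x,\bar v)(w)=A(w)+N_{\overline K}(w)\quad\text{for all } w\in\mathbf X.$$
   Context: Set limits are in the Painlevé–Kuratowski sense. For a set $\Omega$ and $x\in\Omega$: $T_\Omega(x)=\limsup_{t\searrow0}\frac{\Omega-x}{t}$ (tangent cone), $\widehat T_\Omega(x)=\liminf_{x'\to x,\,x'\in\Omega,\,t\searrow0}\frac{\Omega-x'}{t}$ (regular tangent cone), $\widetilde T_\Omega(x)=\limsup_{x'\to x,\,x'\in\Omega,\,t\searrow0}\frac{\Omega-x'}{t}$ (paratingent cone). The regular normal cone is the polar $\widehat N_\Omega(x)=T_\Omega(x)^*$; the limiting normal cone $N_\Omega(\bar x)$ consists of limits of $v^k\in\widehat N_\Omega(x^k)$ with $x^k\to\bar x$, $x^k\in\Omega$. For a linear subspace $\overline K$, $N_{\overline K}(w)=\overline K^\perp$ if $w\in\overline K$ and $\emptyset$ otherwise.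 $\delta_{\overline K}$ is the indicator function ($0$ on $\overline K$, $\infty$ elsewhere). For $f$ with $f(\bar x)$ finite, $\partial f(\bar x)=\{v\mid(v,-1)\in N_{\mathrm{epi}f}(\bar x,f(\bar x))\}$. $f$ is prox-regular at $\bar x$ for $\bar v$ if $f$ is finite at $\bar x$, locally lower semicontinuous around $\bar x$, $\bar v\in\partial f(\bar x)$, and there exist $\varepsilon>0$, $r\ge0$ such that $f(x')\ge f(x)+\langle v,x'-x\rangle-\frac r2\|x'-x\|^2$ for all $x'$ with $\|x'-\bar x\|\le\varepsilon$ whenever $v\in\partial f(x)$, $\|(x,v)-(\bar x,\bar v)\|\le\varepsilon$ and $f(x)<f(\bar x)+\varepsilon$. $f$ is subdifferentially continuous at $\bar x$ for $\bar v$ if $(x^k,v^k)\to(\bar x,\bar v)$ with $v^k\in\partial f(x^k)$ implies $f(x^k)\to f(\bar x)$. The second subderivative is $\mathrm d^2f(\bar x,\bar v)(w)=\liminf_{t\searrow0,\,w'\to w}\frac{f(\bar x+tw')-f(\bar x)-t\langle\bar v,w'\rangle}{\frac12t^2}$, and its domain is the set where it is $<\infty$. For a set-valued mapping $F$ and $(x,y)\in\mathrm{gph}\,F$: $\eta\in DF(x,y)(w)\iff(w,\eta)\in T_{\mathrm{gph}F}(x,y)$ (graphical derivative); $\eta\in D^*F(x,y)(w)\iff(\eta,-w)\in N_{\mathrm{gph}F}(x,y)$ (coderivative); $F$ is strictly proto-differentiable at $x$ for $y$ if $\widehat T_{\mathrm{gph}F}(x,y)=\widetilde T_{\mathrm{gph}F}(x,y)$.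 *)

(* Defs.v *)
From HB Require Import structures.
From mathcomp Require Import all_boot all_order all_algebra.
From mathcomp Require Import sesquilinear.
From mathcomp Require Import all_classical all_reals all_analysis.

Set Implicit Arguments.
Unset Strict Implicit.
Unset Printing Implicit Defensive.

Import Order.TTheory GRing.Theory Num.Theory.
Import numFieldNormedType.Exports.

Local Open Scope classical_set_scope.
Local Open Scope ring_scope.

(* Finite dimensional normed spaces.  A finite dimensional Hilbert space is a
   [normedVectType] together with a [dot : {dot X for idfun}] that induces its
   norm. *)
#[short(type="normedVectType")]
HB.structure Definition NormedVector (R : numFieldType) :=
  {V of NormedModule R V & Vector R V}.

Definition induces_norm (R : realType) (X : normedModType R)
  (dot : X -> X -> R) : Prop := forall x : X, `|x| = Num.sqrt (dot x x).

(* The topology of a product is the product topology, but its library norm is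
   the max norm: Euclidean lengths and polars in X * X and X * R are therefore
   expressed through this scalar product. *)
Definition prod_dot (R : realType) (U V : Type)
  (dU : U -> U -> R) (dV : V -> V -> R) (p q : U * V) : R :=
  dU p.1 q.1 + dV p.2 q.2.

Section SetLimits.
Context {P : Type} {V : topologicalType}.
Implicit Types (F : set_system P) (S : P -> set V).

(* Painleve-Kuratowski outer and inner limits of S p as p runs along F. *)
Definition outer_limit F S : set V :=
  [set w | exists (p_ : nat -> P) (w_ : nat -> V),
    [/\ p_ @ \oo --> F, w_ @ \oo --> w & forall k, S (p_ k) (w_ k)]].

Definition inner_limit F S : set V :=
  [set w | forall p_ : nat -> P, p_ @ \oo --> F ->
    exists2 w_ : nat -> V,
      w_ @ \oo --> w & \forall k \near \oo, S (p_ k) (w_ k)].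

End SetLimits.

Section Cones.
Context {R : realType} {V : normedModType R}.
Implicit Types (Om : set V) (x : V).

Definition diff_quotient Om x (t : R) : set V :=
  [set t^-1 *: (y - x) | y in Om].

Definition tangent_cone Om x : set V :=
  outer_limit 0^'+ (diff_quotient Om x).

Definition regular_tangent_cone Om x : set V :=
  inner_limit (filter_prod (within Om (nbhs x)) 0^'+)
    (fun p : V * R => diff_quotient Om p.1 p.2).

Definition paratingent_cone Om x : set V :=
  outer_limit (filter_prod (within Om (nbhs x)) 0^'+)
    (fun p : V * R => diff_quotient Om p.1 p.2).

Variable dot : V -> V -> R.

Definition polar (C : set V) : set V :=
  [set v | forall w, C w -> dot v w <= 0].

Definition regular_normal_cone Om x : set V := polar (tangent_cone Om x).

Definition normal_cone Om x : set V :=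
  [set v | exists (x_ v_ : nat -> V),
    [/\ x_ @ \oo --> x, v_ @ \oo --> v, forall k, Om (x_ k)
      & forall k, regular_normal_cone Om (x_ k) (v_ k)]].

End Cones.

Section GeneralizedDerivatives.
Context {R : realType} {X : normedModType R}.
Variable dot : X -> X -> R.
Implicit Type F : X -> set X.

Definition gph F : set (X * X)%type := [set p | F p.1 p.2].

Definition graphical_derivative F (x y w : X) : set X :=
  [set eta | tangent_cone (gph F) (x, y) (w, eta)].

Definition coderivative F (x y w : X) : set X :=
  [set eta | normal_cone (prod_dot dot dot) (gph F) (x, y) (eta, - w)].

Definition strictly_proto_differentiable F (x y : X) : Prop :=
  regular_tangent_cone (gph F) (x, y) = paratingent_cone (gph F) (x, y).

End GeneralizedDerivatives.

Section Subdifferentials.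
Context {R : realType} {X : normedModType R}.
Variables (dot : X -> X -> R) (f : X -> \bar R).

Definition epi : set (X * R)%type := [set p | (f p.1 <= p.2%:E)%E].

Definition subdifferential (x : X) : set X :=
  [set v | f x \is a fin_num /\
    normal_cone (prod_dot dot *%R) epi (x, fine (f x)) (v, -1)].

(* Rockafellar-Wets, Variational Analysis, Definition 1.33. *)
Definition locally_lsc (xbar : X) : Prop :=
  exists2 eps : R, 0 < eps &
    forall alpha : R, (alpha%:E <= f xbar + eps%:E)%E ->
      closed [set x | `|x - xbar| <= eps /\ (f x <= alpha%:E)%E].

Definition prox_regular (xbar vbar : X) : Prop :=
  [/\ f xbar \is a fin_num, locally_lsc xbar, subdifferential xbar vbar &
    exists eps r : R, [/\ 0 < eps, 0 <= r &
      forall x v : X, subdifferential x v ->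
        Num.sqrt (`|x - xbar| ^+ 2 + `|v - vbar| ^+ 2) <= eps ->
        (f x < f xbar + eps%:E)%E ->
        forall x' : X, `|x' - xbar| <= eps ->
          (f x + (dot v (x' - x) - r / 2 * `|x' - x| ^+ 2)%:E <= f x')%E]].

Definition subdifferentially_continuous (xbar vbar : X) : Prop :=
  forall x_ v_ : nat -> X,
    x_ @ \oo --> xbar -> v_ @ \oo --> vbar ->
    (forall k, subdifferential (x_ k) (v_ k)) ->
    f (x_ k) @[k --> \oo] --> f xbar.

Definition second_subderivative (xbar vbar w : X) : \bar R :=
  limf_einf
    (fun p : R * X =>
       (f (xbar + p.1 *: p.2)%R - f xbar - (p.1 * dot vbar p.2)%:E)
         * ((2^-1 * p.1 ^+ 2)^-1)%:E)%E
    (filter_prod 0^'+ (nbhs w)).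

Definition dom_second_subderivative (xbar vbar : X) : set X :=
  [set w | (second_subderivative xbar vbar w < +oo)%E].

End Subdifferentials.

Definition indicator_function (R : realType) (X : Type) (K : set X) (w : X) : \bar R :=
  if `[< K w >] then 0%E else +oo%E.

Definition represents_second_subderivative (R : realType) (X : normedModType R)
    (dot : X -> X -> R) (f : X -> \bar R) (xbar vbar : X)
    (A : {linear X -> X}) : Prop :=
  (forall u v : X, dot (A u) v = dot u (A v)) /\
  (forall w : X, second_subderivative dot f xbar vbar w =
    (dot (A w) w)%:E
      + indicator_function R (dom_second_subderivative dot f xbar vbar) w)%E.

(* Main.v *)
Require Import Defs.
From HB Require Import structures.
From mathcomp Require Import all_boot all_order all_algebra.
From mathcomp Require Import sesquilinear.
From mathcomp Require Import all_classical all_reals all_analysis.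
From mathcomp Require Import ring lra.

Import Order.TTheory GRing.Theory Num.Theory.
Import numFieldNormedType.Exports.

Set Implicit Arguments.
Unset Strict Implicit.
Unset Printing Implicit Defensive.

Local Open Scope classical_set_scope.
Local Open Scope ring_scope.

(** Write G for the graph of the subdifferential of f and L for the regular tangent cone
    of G at (xbar, vbar).

    Geometry of G.  A regular tangent cone is closed under addition and nonnegative
    scaling, and a paratingent cone under negation.  As the two agree, L is a linear
    subspace (regular_tangent_cone_linear); it is also the tangent cone, and the limiting
    normal cone is its polar (normal_cone_strict), that is its orthogonal complement.
    So (w, e) is in the graph of the graphical derivative when it lies in L, and in the
    graph of the coderivative when (e, - w) is orthogonal to L, i.e. when
    <e, u> = <z, w> for all (u, z) in L.  The two derivatives coincide as soon as L is
    Lagrangian for the symplectic form <e, u> - <z, w>.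

    L is isotropic.  Prox-regularity bounds f from below near a graph point by a quadratic
    function.  Used in both directions between neighbouring graph points at scale t it
    shows that, along graph points leaving (xbar, vbar) in the direction (w, e), f has the
    second-order expansion with coefficient <e, w> / 2 (quot_cvg).  In the limit the
    prox-regularity inequality becomes an inequality between these quadratic values on the
    linear space L, and its first-order part is the symmetry of the form (w, e), (u, z)
    |-> <e, u> (graph_isotropic).

    L is maximal.  For every z, minimising f - <vbar + t z, . - xbar>
    + (r + 1) / 2 |. - xbar|^2 near xbar gives a graph point at distance O(t) from
    (xbar, vbar); by compactness L contains some (w, e) with e + (r + 1) w = z
    (tangent_subdifferential_onto).  An isotropic L with this property is equal to its
    symplectic complement (lagrangian_maximal).

    The second subderivative.  The expansion above gives d^2 f (w) = <e, w> for (w, e) in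
    L.  If w is not in the domain of L, the component of w orthogonal to this domain spans
    a line of vertical elements (0, z) of L, and the lower bounds that they give force
    d^2 f (w) = +oo.  Hence K is the domain of L, and any symmetric A representing
    d^2 f satisfies <A w, w> = <e, w> on L; polarising, L consists of the (w, e) with w in
    K and e - A w orthogonal to K (lagrangian_graph), which is the stated formula. *)

(** * Sequences *)

Section Sequences.
Context {R : realType}.

Lemma cvg_filter_prod (P Q : Type) (F : set_system P) (G : set_system Q)
    (FF : Filter F) (GG : Filter G) (p : nat -> P * Q) :
  p @ \oo --> filter_prod F G <->
  (fst \o p) @ \oo --> F /\ (snd \o p) @ \oo --> G.
Proof.
split=> [h|[h1 h2]].
  split=> A FA.
    have /h// : filter_prod F G [set q | A q.1].
    by exists (A, setT) => [|[x y] []//]; split=> //; exact: filterT.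
  have /h// : filter_prod F G [set q | A q.2].
  by exists (setT, A) => [|[x y] []//]; split=> //; exact: filterT.
move=> S [[A B] /= [FA GB] sub].
have a : \forall k \near \oo, A (p k).1 := h1 _ FA.
have b : \forall k \near \oo, B (p k).2 := h2 _ GB.
by apply: filterS2 a b => k ak bk; apply: sub.
Qed.

Lemma cvg_withinE (V : topologicalType) (A : set V) (x : V) (p : nat -> V) :
  p @ \oo --> within A (nbhs x) <->
  p @ \oo --> x /\ \forall k \near \oo, A (p k).
Proof.
split=> [h|[h1 h2] S xS].
  split=> [S xS|]; first by apply: h; apply: filterS xS => y.
  by apply: h; apply: withinT.
have a : \forall k \near \oo, A (p k) -> S (p k) := h1 _ xS.
by apply: filterS2 a h2 => k hk /hk.
Qed.

Lemma cvg_at_right0P (t : nat -> R) :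
  t @ \oo --> 0^'+ <-> t @ \oo --> (0 : R) /\ \forall k \near \oo, 0 < t k.
Proof. exact: cvg_withinE. Qed.

Lemma cvg_harmonic_right : (harmonic : nat -> R) @ \oo --> 0^'+.
Proof.
apply/cvg_at_right0P; split; first exact: cvg_harmonic.
by apply: nearW => k; rewrite invr_gt0.
Qed.

Lemma increasing_seq_cvg (phi : nat -> nat) : increasing_seq phi -> phi @ \oo --> \oo.
Proof.
move=> /increasing_seqP phi_incr; apply/cvgnyPge => A; near=> n.
suff le_phi : forall m, (m <= phi m)%N.
  by apply: leq_trans (le_phi n); near: n; exact: nbhs_infty_ge.
elim=> // m IH; apply: leq_ltn_trans IH _; exact: phi_incr.
Unshelve. all: by end_near. Qed.

Lemma cvg_prodP (U V : topologicalType) (p : nat -> U * V) (x : U) (y : V) :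
  p @ \oo --> (x, y) <-> (fst \o p) @ \oo --> x /\ (snd \o p) @ \oo --> y.
Proof. exact: cvg_filter_prod. Qed.

Lemma near_ball_seq (V : normedModType R) (u : nat -> V) (l : V) (e : R) :
  u @ \oo --> l -> 0 < e -> \forall k \near \oo, `|u k - l| < e.
Proof. by move=> /cvgrPdistC_lt; apply. Qed.

Lemma cvg_inv_succ (V : normedModType R) (u : nat -> V) (l : V) :
  (forall k, `|u k - l| <= harmonic k) -> u @ \oo --> l.
Proof.
move=> h; apply/cvgrPdist_le => e e0.
have /cvgrPdist_le/(_ _ e0) := @cvg_harmonic R; apply: filterS => k.
by rewrite sub0r normrN distrC; apply: le_trans; rewrite ger0_norm ?h // invr_ge0.
Qed.

Lemma harmonic_gt0 k : 0 < harmonic k :> R.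
Proof. by rewrite invr_gt0. Qed.

Lemma cvg_tail (T : Type) (F : set_system T) (u : nat -> T) {N} :
  u @ \oo --> F -> u (k + N)%N @[k --> \oo] --> F.
Proof. by move=> uF; apply: cvg_comp uF; exact: cvg_addnr. Qed.

Lemma cvg_step (V : normedModType R) (t_ : nat -> R) (w_ : nat -> V) (w x : V) :
  t_ @ \oo --> (0 : R) -> w_ @ \oo --> w -> x + t_ k *: w_ k @[k --> \oo] --> x.
Proof.
move=> t0 ww; rewrite -[X in _ --> X]addr0 -(scale0r w).
by apply: cvgD; [exact: cvg_cst | exact: cvgZ].
Qed.

Lemma cvg_sq_norm (V : normedModType R) (u : nat -> V) (l : V) :
  u @ \oo --> l -> `|u k| ^+ 2 @[k --> \oo] --> `|l| ^+ 2.
Proof.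
move=> ul; apply: (cvgM (f := fun k => `|u k|) (g := fun k => `|u k|));
  exact: cvg_norm.
Qed.

End Sequences.

(** * Orthogonality and compactness in a finite-dimensional Hilbert space *)

Section InnerProduct.
Context {R : realType} {X : normedVectType R} {dot : {dot X for idfun}}.
Hypothesis dot_norm : induces_norm dot.
Implicit Types x y z : X.

Lemma dotC x y : dot x y = dot y x.
Proof. by rewrite hermC expr0 mul1r. Qed.

Lemma dotDl x y z : dot (x + y) z = dot x z + dot y z.
Proof. exact: linearDl. Qed.
Lemma dotDr x y z : dot z (x + y) = dot z x + dot z y.
Proof. exact: linearDr. Qed.
Lemma dotZl a x y : dot (a *: x) y = a * dot x y.
Proof. exact: linearZl_LR. Qed.
Lemma dotZr a x y : dot x (a *: y) = a * dot x y.
Proof. by rewrite dotC dotZl dotC. Qed.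
Lemma dotNl x y : dot (- x) y = - dot x y.
Proof. by rewrite -scaleN1r dotZl mulN1r. Qed.
Lemma dotNr x y : dot x (- y) = - dot x y.
Proof. by rewrite dotC dotNl dotC. Qed.
Lemma dotBl x y z : dot (x - y) z = dot x z - dot y z.
Proof. by rewrite dotDl dotNl. Qed.
Lemma dotBr x y z : dot z (x - y) = dot z x - dot z y.
Proof. by rewrite dotDr dotNr. Qed.
Lemma dot0l x : dot 0 x = 0.
Proof. by rewrite -(scale0r x) dotZl mul0r. Qed.
Lemma dot0r x : dot x 0 = 0.
Proof. by rewrite dotC dot0l. Qed.
Definition dotE := (dotDl, dotDr, dotNl, dotNr, dotZl, dotZr, dot0l, dot0r).

Lemma dot_gt0 x : x != 0 -> 0 < dot x x.
Proof. exact: neq0_dnorm_gt0. Qed.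

Lemma dot_ge0 x : 0 <= dot x x.
Proof. by have [->|/dot_gt0/ltW//] := eqVneq x 0; rewrite dot0l. Qed.

Lemma dot_eq0 x : dot x x = 0 -> x = 0.
Proof. by have [//|/dot_gt0 + h] := eqVneq x 0; rewrite h ltxx. Qed.

Lemma dot_normE x : dot x x = `|x| ^+ 2.
Proof. by rewrite dot_norm sqr_sqrtr // dot_ge0. Qed.

Lemma cauchy_schwarz x y : `|dot x y| <= `|x| * `|y|.
Proof.
rewrite -ler_sqr ?nnegrE ?mulr_ge0 // real_normK ?num_real // exprMn -!dot_normE.
have [->|/dot_gt0 y_gt0] := eqVneq y 0; first by rewrite !dot0r expr0n mulr0.
have := dot_ge0 (dot y y *: x - dot x y *: y).
have -> : dot (dot y y *: x - dot x y *: y) (dot y y *: x - dot x y *: y)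
          = dot y y * (dot x x * dot y y - dot x y ^+ 2).
  by rewrite !dotE (dotC y x); ring.
by rewrite pmulr_rge0 // subr_ge0.
Qed.

Lemma cvg_dot (x_ y_ : nat -> X) x y : x_ @ \oo --> x -> y_ @ \oo --> y ->
  dot (x_ k) (y_ k) @[k --> \oo] --> dot x y.
Proof.
move=> xx yy.
have xl : dot (x_ k - x) (y_ k) @[k --> \oo] --> (0 : R).
  apply/norm_cvg0P.
  apply: (@squeeze_cvgr _ _ _ _ (cst 0) (fun k => `|x_ k - x| * `|y_ k|)).
  - by apply: nearW => k; rewrite normr_ge0 cauchy_schwarz.
  - exact: cvg_cst.
  - rewrite -[X in _ --> X](mul0r `|y|) -(normr0 X) -(subrr x).
    by apply: cvgM; [apply: cvg_norm; apply: cvgB => //; exact: cvg_cst | exact: cvg_norm].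
have xr : dot x (y_ k - y) @[k --> \oo] --> (0 : R).
  apply/norm_cvg0P.
  apply: (@squeeze_cvgr _ _ _ _ (cst 0) (fun k => `|x| * `|y_ k - y|)).
  - by apply: nearW => k; rewrite normr_ge0 cauchy_schwarz.
  - exact: cvg_cst.
  - rewrite -[X in _ --> X](mulr0 `|x|) -(normr0 X) -(subrr y).
    by apply: cvgM; [exact: cvg_cst | apply: cvg_norm; apply: cvgB => //; exact: cvg_cst].
have -> : (fun k => dot (x_ k) (y_ k)) =
   (fun k => dot (x_ k - x) (y_ k) + (dot x (y_ k - y) + dot x y)).
  by apply/funext => k; rewrite !dotE; ring.
rewrite -[X in _ --> X]add0r -[X in _ --> _ + X]add0r.
by apply: cvgD => //; apply: cvgD => //; exact: cvg_cst.
Qed.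

(** Induction on a spanning list of U: a new generator contributes its component b
    orthogonal to the previous ones, as in the Gram-Schmidt process. *)
Lemma orth_projection (U : {vspace X}) x :
  exists2 k, k \in U & forall y, y \in U -> dot (x - k) y = 0.
Proof.
rewrite -(span_basis (vbasisP U)).
elim: (tval (vbasis U)) x => [|a s IH] x.
  by exists 0; rewrite ?mem0v // => y; rewrite span_nil memv0 => /eqP ->; rewrite dot0r.
have [p ps pa] := IH a; have [k ks kx] := IH x.
set b := a - p; set c := dot x b / dot b b.
have bs : b \in <<a :: s>>%VS.
  rewrite span_cons memv_add ?memv_line // memvN //.
exists (k + c *: b).
  rewrite memvD ?memvZ //; apply: subvP ks; rewrite span_cons; exact: addvSr.
move=> y; rewrite span_cons => /memv_addP[_ /vlineP[d ->] [z zs ->]].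
have -> : d *: a + z = d *: b + (d *: p + z) by rewrite scalerBr addrA subrK.
have e1 : dot (x - k) (d *: p + z) = 0 by apply: kx; rewrite memvD ?memvZ.
have e2 : dot b (d *: p + z) = 0 by apply: pa; rewrite memvD ?memvZ.
have e3 : dot k b = 0 by rewrite dotC pa.
rewrite opprD addrA dotBl dotDr e1 addr0 (dotZl c) dotDr e2 addr0 !dotZr dotBl e3 subr0.
have [b0|b0] := eqVneq b 0; first by rewrite b0 !dot0r !mulr0 subrr.
by rewrite /c mulrCA mulrVK ?unitfE ?gt_eqF ?dot_gt0 // subrr.
Qed.

(** The same induction: the new generator is made orthogonal to the previous ones, which
    bounds its coefficient, and the real Bolzano-Weierstrass theorem applies to it. *)
Lemma bounded_subseq (x_ : nat -> X) (M : R) : (forall k, `|x_ k| <= M) ->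
  exists2 phi : nat -> nat, phi @ \oo --> \oo & exists l : X, (x_ \o phi) @ \oo --> l.
Proof.
have xf k : x_ k \in <<vbasis {:X}>>%VS by rewrite (span_basis (vbasisP _)) memvf.
elim: (tval (vbasis {:X})) x_ M xf => [|a s IH] x_ M xs bx.
  exists id; first exact: cvg_id.
  exists 0; rewrite (_ : _ \o _ = cst 0); first exact: cvg_cst.
  by apply/funext => k /=; have := xs k; rewrite span_nil memv0 => /eqP ->.
have M0 : 0 <= M := le_trans (normr_ge0 _) (bx 0%N).
have [p ps pa] := orth_projection << s >>%VS a.
set b := a - p; pose c k := dot (x_ k) b / dot b b.
have ys k : x_ k - c k *: b \in << s >>%VS.
  have := xs k; rewrite span_cons => /memv_addP[_ /vlineP[d ->] [z zs xE]].
  have xE' : x_ k = d *: b + (d *: p + z) by rewrite xE scalerBr addrA subrK.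
  have zz : d *: p + z \in << s >>%VS by rewrite memvD ?memvZ.
  have [b0|b0] := eqVneq b 0; first by rewrite b0 scaler0 subr0 xE' b0 scaler0 add0r.
  have -> : c k = d.
    by rewrite /c xE' dotDl dotZl (dotC _ b) (pa _ zz) addr0 mulfK // gt_eqF ?dot_gt0.
  by rewrite xE' addrC addKr.
have bc k : `|c k| <= M * `|b| / dot b b.
  rewrite normrM normfV (ger0_norm (dot_ge0 b)) ler_wpM2r ?invr_ge0 ?dot_ge0 //.
  by apply: le_trans (cauchy_schwarz _ _) _; rewrite ler_wpM2r.
have by' k : `|x_ k - c k *: b| <= M + M * `|b| / dot b b * `|b|.
  by rewrite (le_trans (ler_normB _ _)) // lerD // normrZ ler_wpM2r.
have [|f f_incr /cvg_ex[/= d cd]] := @bolzano_weierstrass R c.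
  exists (M * `|b| / dot b b); split=> [|z zM k _]; first exact: num_real.
  exact: le_trans (bc k) (ltW zM).
have {}f_incr := increasing_seq_cvg f_incr.
have [g gf [l yl]] := IH _ _ (fun k => ys (f k)) (fun k => by' (f k)).
exists (f \o g); first exact: cvg_comp gf f_incr.
exists (l + d *: b).
have -> : x_ \o (f \o g) =
    (((fun k => x_ (f k) - c (f k) *: b) \o g) + (fun k => (c \o f \o g) k *: b)).
  by apply/funext => k; rewrite !fctE /= subrK.
have cgd : (c \o f \o g) @ \oo --> d by exact: cvg_comp gf cd.
by apply: cvgD => //; exact: cvgZr_tmp.
Qed.

End InnerProduct.

(** * Linear subspaces and Lagrangian relations *)

Definition linear_set (R : realType) (V : lmodType R) (S : set V) : Prop :=
  S 0 /\ forall a x y, S x -> S y -> S (a *: x + y).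

Section LinearSets.
Context {R : realType} {X : normedVectType R} {dot : {dot X for idfun}}.
Hypothesis dot_norm : induces_norm dot.

(** A vector subspace of maximal dimension among those contained in K must be all of K,
    since adjoining a line to it would increase its dimension. *)
Lemma linear_set_vspace (K : set X) : linear_set K -> exists U : {vspace X}, K = [set` U].
Proof.
move=> [K0 Klin].
pose P n := `[< exists2 U : {vspace X}, \dim U = n & forall x, x \in U -> K x >].
have P0 : exists n, P n.
  exists 0%N; apply/asboolP; exists 0%VS; first exact: dimv0.
  by move=> x; rewrite memv0 => /eqP ->.
have Pub n : P n -> (n <= \dim {:X})%N.
  by move=> /asboolP[U <- _]; exact: dimvS (subvf U).
case: (ex_maxnP P0 Pub) => n /asboolP[U Un UK] nmax.
exists U; apply/seteqP; split=> x /= xP; last exact: UK.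
apply/negPn/negP => xU.
suff : (\dim (U + <[x]>) <= n)%N.
  move=> le_n; have := dimvS (addvSl U <[x]>); rewrite Un => ge_n.
  have /eqP UE : U == (U + <[x]>)%VS by rewrite eqEdim addvSl Un.
  by move/negP: xU; apply; rewrite UE memvE addvSr.
apply: nmax; apply/asboolP; exists (U + <[x]>)%VS => // z.
move=> /memv_addP[u uU [_ /vlineP[c ->] ->]]; rewrite addrC.
by apply: Klin => //; exact: UK.
Qed.

Lemma linear_set_projection (K : set X) x : linear_set K ->
  exists2 k, K k & forall y, K y -> dot (x - k) y = 0.
Proof. by move=> /linear_set_vspace[U ->]; exact: orth_projection. Qed.

Lemma linear_setN (V : lmodType R) (S : set V) x : linear_set S -> S x -> S (- x).
Proof. by move=> [S0 Sl] Sx; rewrite -[- x]addr0 -scaleN1r; apply: Sl. Qed.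

Lemma linear_setZ (V : lmodType R) (S : set V) a x : linear_set S -> S x -> S (a *: x).
Proof. by move=> [S0 Sl] Sx; rewrite -[a *: x]addr0; apply: Sl. Qed.

Lemma linear_setD (V : lmodType R) (S : set V) x y : linear_set S -> S x -> S y -> S (x + y).
Proof. by move=> [S0 Sl] Sx Sy; rewrite -[x]scale1r; apply: Sl. Qed.

Lemma linear_setB (V : lmodType R) (S : set V) x y : linear_set S -> S x -> S y -> S (x - y).
Proof. by move=> Sl Sx Sy; apply: linear_setD => //; exact: linear_setN. Qed.

(** The residual x - k of the projection k of x is orthogonal to K, hence to x as a limit
    of points of K, hence to itself. *)
Lemma linear_set_closed (K : set X) (x_ : nat -> X) x : linear_set K ->
  (forall n, K (x_ n)) -> x_ @ \oo --> x -> K x.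
Proof.
move=> Kl Kx xx; have [k Kk xk] := linear_set_projection x Kl.
suff /dot_eq0/eqP : dot (x - k) (x - k) = 0 by rewrite subr_eq0 => /eqP ->.
rewrite [LHS]dotBr (xk _ Kk) subr0.
apply: (@cvg_unique _ _ (dot (x - k) (x_ n) @[n --> \oo])).
- exact: norm_hausdorff.
- by apply: cvg_dot => //; exact: cvg_cst.
- rewrite (_ : (fun n => _) = cst 0); first exact: cvg_cst.
  by apply/funext => n; exact: xk.
Qed.

Lemma tangent_cone_linear_set (K : set X) x : linear_set K -> K x -> tangent_cone K x = K.
Proof.
move=> Kl Kx; apply/seteqP; split=> w.
  move=> [t [w_ [_ ww h]]]; apply: linear_set_closed ww => // n.
  by have [y Ky <-] := h n; apply: linear_setZ => //; exact: linear_setB.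
move=> Kw; exists harmonic, (fun=> w); split; [exact: cvg_harmonic_right|exact: cvg_cst|].
move=> n; exists (harmonic n *: w + x); first by apply: Kl.2.
by rewrite addrK scalerA mulVf ?scale1r // gt_eqF // invr_gt0.
Qed.

Lemma normal_cone_linear_set (K : set X) w : linear_set K ->
  normal_cone dot K w = [set z | K w /\ forall y, K y -> dot z y = 0].
Proof.
move=> Kl; apply/seteqP; split=> z /=.
  move=> [x_ [v_ [xw vz Kx Nv]]]; split; first exact: linear_set_closed xw.
  move=> y Ky; have v0 k : dot (v_ k) y = 0.
    have le0 y' : K y' -> dot (v_ k) y' <= 0.
      by move=> Ky'; apply: (Nv k); rewrite tangent_cone_linear_set.
    apply/eqP; rewrite eq_le le0 //= -oppr_le0 -dotNr le0 //; exact: linear_setN.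
  apply: (@cvg_unique _ _ (dot (v_ n) y @[n --> \oo])).
  - exact: norm_hausdorff.
  - by apply: cvg_dot => //; exact: cvg_cst.
  - by rewrite (_ : (fun n => _) = cst 0); [exact: cvg_cst|exact/funext].
move=> [Kw zK]; exists (fun=> w), (fun=> z); split=> //; [exact: cvg_cst|exact: cvg_cst|].
by move=> _ y; rewrite tangent_cone_linear_set // => /zK ->.
Qed.

End LinearSets.

(** A linear relation L on X is isotropic for the symplectic form that sends the pairs
    (w, e) and (u, z) to <e, u> - <z, w>, and it is large enough because its image under
    (w, e) |-> e + mu w is all of X: it is Lagrangian. *)
Section LagrangianRelation.
Context {R : realType} {X : normedVectType R} {dot : {dot X for idfun}}.
Hypothesis dot_norm : induces_norm dot.
Variables (L : set (X * X)) (mu : R).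
Hypothesis L_linear : linear_set L.
Hypothesis L_isotropic : forall w e u z, L (w, e) -> L (u, z) -> dot e u = dot z w.
Hypothesis L_onto : forall z, exists w e, L (w, e) /\ e + mu *: w = z.

(** Subtracting from (w, e) the element of L with the same image e + mu w leaves a pair
    (a, - mu a) symplectically orthogonal to L, so a is orthogonal to every z + mu u,
    that is to X. *)
Lemma lagrangian_maximal w e :
  (forall u z, L (u, z) -> dot e u = dot z w) -> L (w, e).
Proof.
move=> we; have [w' [e' [L' eq]]] := L_onto (e + mu *: w).
have eE : e - e' = - (mu *: (w - w')).
  by apply/eqP; rewrite -subr_eq0 opprK scalerBr addrACA -opprD -eq subrr.
have w0 x : dot x (w - w') = 0.
  have [u [z [Luz <-]]] := L_onto x.
  have : dot (e - e') u = dot z (w - w').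
    by rewrite dotBl dotBr (we _ _ Luz) (L_isotropic L' Luz).
  by rewrite eE dotDl dotNl !dotZl (dotC u) => <-; rewrite addNr.
have /eqP : w - w' = 0 by apply: dot_eq0 (w0 _).
rewrite subr_eq0 => /eqP ww; move: eE; rewrite ww subrr scaler0 oppr0.
by move=> /eqP; rewrite subr_eq0 => /eqP ->.
Qed.

Definition rel_dom : set X := [set w | exists e, L (w, e)].

Lemma rel_dom_linear : linear_set rel_dom.
Proof.
split; first by exists 0; exact: L_linear.1.
by move=> a x y [e1 L1] [e2 L2]; exists (a *: e1 + e2); exact: L_linear.2 L1 L2.
Qed.

Lemma rel_dom_orthogonal z : (forall y, rel_dom y -> dot z y = 0) -> L (0, z).
Proof.
move=> zK; apply: lagrangian_maximal => u e Lu.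
by rewrite dot0r zK //; exists e.
Qed.

(** Polarising the equality of quadratic forms with the isotropy of L shows that e - A w is
    orthogonal to the domain; conversely such pairs are symplectically orthogonal to L, so
    maximality puts them in L. *)
Lemma lagrangian_graph (A : X -> X) :
  (forall u v, dot (A u) v = dot u (A v)) -> {morph A : x y / x + y} ->
  (forall w e, L (w, e) -> dot (A w) w = dot e w) ->
  forall w e, L (w, e) <-> rel_dom w /\ forall y, rel_dom y -> dot (e - A w) y = 0.
Proof.
move=> As AD Aq.
have LA w e : L (w, e) -> rel_dom w /\ forall y, rel_dom y -> dot (e - A w) y = 0.
  move=> Lwe; split; first by exists e.
  move=> y [z Lyz].
  have := Aq _ _ (linear_setD L_linear Lwe Lyz).
  rewrite /= AD !dotE (Aq _ _ Lwe) (Aq _ _ Lyz) (As y w) (dotC y (A w)).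
  by rewrite -(L_isotropic Lwe Lyz); lra.
move=> w e; split; first exact: LA.
move=> [Kw eA]; apply: lagrangian_maximal => u z Luz.
have := eA u (ex_intro _ z Luz); have [_ /(_ _ Kw)] := LA _ _ Luz.
rewrite !dotBl (As u w) (dotC u (A w)); lra.
Qed.

(** A is the compression of L to its domain K: project on K, apply L, project on K again.
    Isotropy makes this relation symmetric, hence single-valued and linear. *)
Lemma lagrangian_representative :
  exists A : {linear X -> X}, (forall u v, dot (A u) v = dot u (A v)) /\
    forall w e, L (w, e) -> dot (A w) w = dot e w.
Proof.
pose Phi w y := exists k e, [/\ L (k, e), rel_dom y,
  forall x, rel_dom x -> dot (w - k) x = 0 & forall x, rel_dom x -> dot (e - y) x = 0].
have Kl := rel_dom_linear.
have Phi_ex w : exists y, Phi w y.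
  have [k [e Lke] kw] := linear_set_projection (dot := dot) w Kl.
  have [y Ky ye] := linear_set_projection (dot := dot) e Kl.
  by exists y, k, e.
have Phi_sym w y w' y' : Phi w y -> Phi w' y' -> dot y w' = dot w y'.
  move=> [k [e [L1 Ky wk ey]]] [k' [e' [L2 Ky' wk' ey']]].
  have K1 : rel_dom k by exists e.
  have K2 : rel_dom k' by exists e'.
  have := wk _ Ky'; have := wk' _ Ky; have := ey _ K2; have := ey' _ K1.
  rewrite !dotBl (L_isotropic L1 L2) (dotC w' y) (dotC k' y) (dotC k y'); lra.
have Phi_lin a w y w' y' : Phi w y -> Phi w' y' -> Phi (a *: w + w') (a *: y + y').
  move=> [k [e [L1 Ky wk ey]]] [k' [e' [L2 Ky' wk' ey']]].
  exists (a *: k + k'), (a *: e + e'); split.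
  - exact: L_linear.2 L1 L2.
  - exact: Kl.2.
  - by move=> x Kx; rewrite opprD addrACA -scalerBr dotDl dotZl wk // wk' // mulr0 addr0.
  - by move=> x Kx; rewrite opprD addrACA -scalerBr dotDl dotZl ey // ey' // mulr0 addr0.
have [A0 A0P] := choice Phi_ex.
have A0_sym u v : dot (A0 u) v = dot u (A0 v) by exact: Phi_sym.
have A0_lin : linear A0.
  move=> a u v; apply/eqP; rewrite -subr_eq0; apply/eqP/(dot_eq0 (dot := dot)).
  set d := _ - _; rewrite {1}/d dotBl dotDl dotZl !A0_sym.
  by rewrite -dotZl -dotDl subrr.
pose A : {linear X -> X} := HB.pack A0 (GRing.isLinear.Build R X X *:%R A0 A0_lin).
exists A; split=> // w e Lwe.
have Kw : rel_dom w by exists e.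
have [k [e' [Lke Ky wk ey]]] := A0P w.
have /dot_eq0/eqP := wk _ (linear_setB Kl Kw (ex_intro _ e' Lke)).
rewrite subr_eq0 => /eqP wkE.
have := ey _ Kw; rewrite dotBl /= => /eqP; rewrite subr_eq0 => /eqP <-.
by rewrite (L_isotropic Lke Lwe) -wkE.
Qed.

End LagrangianRelation.

(** * Tangent and normal cones of strictly smooth sets *)

Section Cones.
Context {R : realType} {V : normedModType R}.
Implicit Types (Om : set V) (x w : V) (t : R).

Lemma diff_quotientE Om x t w : 0 < t -> diff_quotient Om x t w <-> Om (x + t *: w).
Proof.
move=> t0; split=> [[y Omy <-]|Omw].
  by rewrite scalerA mulfV ?gt_eqF // scale1r addrC subrK.
by exists (x + t *: w) => //; rewrite addrC addKr scalerA mulVf ?gt_eqF // scale1r.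
Qed.

Lemma cvg_basepointP Om x (p : nat -> V * R) :
  p @ \oo --> filter_prod (within Om (nbhs x)) 0^'+ <->
  [/\ (fst \o p) @ \oo --> x, (\forall k \near \oo, Om (p k).1),
      (snd \o p) @ \oo --> (0 : R) & \forall k \near \oo, 0 < (p k).2].
Proof.
rewrite cvg_filter_prod; split=> [[/cvg_withinE[a b] /cvg_at_right0P[c d]]|[a b c d]].
  by [].
by split; [apply/cvg_withinE | apply/cvg_at_right0P].
Qed.

(** Moving along a first approximating direction gives admissible base points for the
    second one. *)
Lemma regular_tangent_coneD Om x w1 w2 : regular_tangent_cone Om x w1 ->
  regular_tangent_cone Om x w2 -> regular_tangent_cone Om x (w1 + w2).
Proof.
move=> h1 h2 p /[dup] px /cvg_basepointP[xx Omx tt t0].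
have [u uw uO] := h1 p px.
pose q k := ((p k).1 + (p k).2 *: u k, (p k).2).
have [|v vw vO] := h2 q.
  apply/cvg_basepointP; split=> //.
    rewrite -[X in _ --> X]addr0 -(scale0r w1); apply: cvgD => //; exact: cvgZ.
  by apply: filterS2 t0 uO => k tk /(diff_quotientE _ _ _ tk).
exists (fun k => u k + v k); first exact: cvgD.
apply: filterS2 t0 vO => k tk /(diff_quotientE _ _ _ tk) /= h.
by apply/diff_quotientE; rewrite // scalerDr addrA.
Qed.

Lemma regular_tangent_coneZ Om x w c : 0 <= c -> regular_tangent_cone Om x w ->
  regular_tangent_cone Om x (c *: w).
Proof.
rewrite le_eqVlt => /predU1P[<- _|c0 h] p /cvg_basepointP[xx Omx tt t0].
  rewrite scale0r; exists (fun=> 0); first exact: cvg_cst.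
  apply: filterS2 t0 Omx => k tk Omk; apply/diff_quotientE => //.
  by rewrite scaler0 addr0.
have [|u uw uO] := h (fun k => ((p k).1, (p k).2 * c)).
  apply/cvg_basepointP; split=> //.
    by rewrite -[X in _ --> X](mul0r c); apply: cvgMr_tmp.
  by apply: filterS t0 => k tk /=; rewrite mulr_gt0.
exists (fun k => c *: u k); first exact: cvgZl_tmp.
apply: filterS2 t0 uO => k tk /(diff_quotientE _ _ _ (mulr_gt0 tk c0)) /= h'.
by apply/diff_quotientE; rewrite // scalerA.
Qed.

Lemma paratingent_coneE Om x w : paratingent_cone Om x w <->
  exists (x_ : nat -> V) (t_ : nat -> R) (w_ : nat -> V),
    [/\ x_ @ \oo --> x, t_ @ \oo --> 0^'+, w_ @ \oo --> w &
      forall k, Om (x_ k) /\ Om (x_ k + t_ k *: w_ k)].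
Proof.
split=> [[p [u [/cvg_basepointP[xx Omx tt t0] uw h]]]|[y [t [u [yx tt uw h]]]]].
  (* membership of the base points only holds eventually: drop the first terms *)
  have [N _ hN] := filterI Omx t0.
  have hN' k : Om (p (k + N)%N).1 /\ 0 < (p (k + N)%N).2 by apply: hN => /=; exact: leq_addl.
  exists (fun k => (p (k + N)%N).1), (fun k => (p (k + N)%N).2), (fun k => u (k + N)%N).
  split.
  - exact: cvg_tail xx.
  - by apply/cvg_at_right0P; split; [exact: cvg_tail tt | apply: nearW => k; apply: (hN' k).2].
  - exact: cvg_tail uw.
  - by move=> k; split; [exact: (hN' k).1 | apply/(diff_quotientE _ _ _ (hN' k).2)].
have [t0 tpos] : t @ \oo --> (0 : R) /\ \forall k \near \oo, 0 < t k by apply/cvg_at_right0P.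
have [N _ hN] := tpos.
exists (fun k => (y (k + N)%N, t (k + N)%N)), (fun k => u (k + N)%N).
have tk k : 0 < t (k + N)%N by apply: hN => /=; exact: leq_addl.
split.
- apply/cvg_basepointP; split; [exact: cvg_tail yx | | exact: cvg_tail t0 |]; apply: nearW => k //=.
  exact: (h _).1.
- exact: cvg_tail uw.
- by move=> k; apply/diff_quotientE => //=; exact: (h _).2.
Qed.

(** The two points defining a difference quotient play symmetric roles. *)
Lemma paratingent_coneN Om x w : paratingent_cone Om x w -> paratingent_cone Om x (- w).
Proof.
move=> /paratingent_coneE[y [t [u [yx tt uw h]]]]; apply/paratingent_coneE.
exists (fun k => y k + t k *: u k), t, (fun k => - u k); split=> //.
- have [t0 _] : t @ \oo --> (0 : R) /\ \forall k \near \oo, 0 < t k by apply/cvg_at_right0P.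
  by rewrite -[X in _ --> X]addr0 -(scale0r w); apply: cvgD => //; exact: cvgZ.
- exact: cvgN.
- by move=> k; have [h1 h2] := h k; split=> //; rewrite scalerN addrK.
Qed.

Lemma tangent_coneE Om x w : tangent_cone Om x w <->
  exists (t_ : nat -> R) (w_ : nat -> V),
    [/\ t_ @ \oo --> 0^'+, w_ @ \oo --> w & forall k, Om (x + t_ k *: w_ k)].
Proof.
split=> [[t [u [tt uw h]]]|[t [u [tt uw h]]]];
  have [t0 tpos] : t @ \oo --> (0 : R) /\ \forall k \near \oo, 0 < t k
    by [apply/cvg_at_right0P]; have [N _ hN] := tpos;
  have tk k : 0 < t (k + N)%N by [apply: hN => /=; exact: leq_addl];
  exists (fun k => t (k + N)%N), (fun k => u (k + N)%N); split.
- exact: cvg_tail tt.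
- exact: cvg_tail uw.
- by move=> k; apply/(diff_quotientE _ _ _ (tk k)).
- exact: cvg_tail tt.
- exact: cvg_tail uw.
- by move=> k; apply/(diff_quotientE _ _ _ (tk k)).
Qed.

Lemma tangent_sub_paratingent Om x : Om x -> tangent_cone Om x `<=` paratingent_cone Om x.
Proof.
move=> Omx w /tangent_coneE[t [u [tt uw h]]]; apply/paratingent_coneE.
by exists (fun=> x), t, u; split=> //; exact: cvg_cst.
Qed.

(** With the base point frozen, a regular tangent direction is reached along every
    sequence of step lengths. *)
Lemma regular_tangent_seq Om x w (t_ : nat -> R) : Om x -> regular_tangent_cone Om x w ->
  (forall k, 0 < t_ k) -> t_ @ \oo --> (0 : R) ->
  exists2 w_ : nat -> V, w_ @ \oo --> w & forall k, Om (x + t_ k *: w_ k).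
Proof.
move=> Omx h t0 tt.
have [|u uw uO] := h (fun k => (x, t_ k)).
  by apply/cvg_basepointP; split=> //; [exact: cvg_cst | exact: nearW | exact: nearW].
exists (fun k => if `[< Om (x + t_ k *: u k) >] then u k else 0).
  apply: cvg_trans uw; apply: near_eq_cvg; apply: filterS uO => k /=.
  by move=> /(diff_quotientE _ _ _ (t0 k)) Ok; case: asboolP.
by move=> k; case: asboolP => // _; rewrite scaler0 addr0.
Qed.

Lemma regular_sub_tangent Om x : Om x -> regular_tangent_cone Om x `<=` tangent_cone Om x.
Proof.
move=> Omx w h; apply/tangent_coneE.
have [u uw uO] := regular_tangent_seq Omx h harmonic_gt0 cvg_harmonic.
by exists harmonic, u; split=> //; exact: cvg_harmonic_right.
Qed.

Section StrictlySmooth.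
Variables (Om : set V) (x : V).
Hypothesis Omx : Om x.
Hypothesis strict : regular_tangent_cone Om x = paratingent_cone Om x.

Lemma tangent_cone_strict : tangent_cone Om x = regular_tangent_cone Om x.
Proof.
apply/seteqP; split; last exact: regular_sub_tangent.
by rewrite strict; exact: tangent_sub_paratingent.
Qed.

(** The regular tangent cone is convex and the paratingent cone is symmetric. *)
Lemma regular_tangent_cone_linear : linear_set (regular_tangent_cone Om x).
Proof.
have TN w : regular_tangent_cone Om x w -> regular_tangent_cone Om x (- w).
  by rewrite strict; exact: paratingent_coneN.
have T0 : regular_tangent_cone Om x 0.
  move=> p /cvg_basepointP[xx Omp tt t0]; exists (fun=> 0); first exact: cvg_cst.
  apply: filterS2 t0 Omp => k tk Omk; apply/diff_quotientE => //.
  by rewrite scaler0 addr0.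
split=> // a w1 w2 h1 h2; apply: regular_tangent_coneD => //.
have [a0|a0] := leP 0 a; first exact: regular_tangent_coneZ.
rewrite -[a]opprK scaleNr; apply: TN; apply: regular_tangent_coneZ => //.
by rewrite oppr_ge0 ltW.
Qed.

End StrictlySmooth.

Section NormalCone.
Variables (Om : set V) (x : V).
Hypothesis V_bounded : forall (x_ : nat -> V) (M : R), (forall k, `|x_ k| <= M) ->
  exists2 phi : nat -> nat, phi @ \oo --> \oo & exists l : V, (x_ \o phi) @ \oo --> l.

(** If a fixed ball around w missed the tangent cones at points x_k tending to x then, by
    compactness of that ball, it would also miss the difference quotients at x_k for some
    arbitrarily short step, against the regularity of w. *)
Lemma regular_tangent_liminf (x_ : nat -> V) w (e : R) :
  x_ @ \oo --> x -> (forall k, Om (x_ k)) -> regular_tangent_cone Om x w -> 0 < e ->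
  \forall k \near \oo, exists2 w', tangent_cone Om (x_ k) w' & `|w' - w| <= e.
Proof.
move=> xx Omx_ Tw e0; apply: contrapT => neg.
have far j : exists kt : nat * R, [/\ (j <= kt.1)%N, 0 < kt.2, kt.2 <= harmonic j &
    forall u, `|u - w| <= e -> ~ Om (x_ kt.1 + kt.2 *: u)].
  have [k jk Tk] : exists2 k, (j <= k)%N &
      ~ exists2 w', tangent_cone Om (x_ k) w' & `|w' - w| <= e.
    apply: contrapT => /forall2NP h; apply: neg; exists j => // k /= jk.
    by have [|/contrapT] := h k.
  apply: contrapT => /forallNP h; apply: Tk.
  have /choice[u uP] i : exists u, `|u - w| <= e /\ Om (x_ k + harmonic (i + j)%N *: u).
    apply: contrapT => /forallNP hu; apply: (h (k, harmonic (i + j)%N)); split=> //=.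
      by rewrite lef_pV2 ?posrE // ler_nat ltnS leq_addl.
    by move=> u0 ue Ou; exact: hu (conj ue Ou).
  have ub i : `|u i| <= e + `|w|.
    by rewrite -[u i](subrK w) (le_trans (ler_normD _ _)) // lerD2r (uP i).1.
  have [phi phioo [l ul]] := V_bounded ub.
  exists l.
    apply/tangent_coneE; exists (fun i => harmonic (phi i + j)%N), (u \o phi).
    split=> // [|i]; last exact: (uP _).2.
    exact: cvg_comp phioo (cvg_tail (N := j) cvg_harmonic_right).
  have lw : `|(u \o phi) i - w| @[i --> \oo] --> `|l - w|.
    by apply: cvg_norm; apply: cvgB => //; exact: cvg_cst.
  by apply: cvgr_to_le lw _; apply: nearW => i; exact: (uP _).1.
have /choice[a aP] := far.
have fst_oo : (fun j => (a j).1) @ \oo --> \oo.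
  apply/cvgnyPge => A; near=> j; apply: (@leq_trans j); last by have [] := aP j.
  by near: j; exact: nbhs_infty_ge.
have a0 j : 0 < (a j).2 by have [] := aP j.
have [|u uw uO] := Tw (fun j => (x_ (a j).1, (a j).2)).
  apply/cvg_basepointP; split; last exact: nearW.
  - exact: cvg_comp fst_oo xx.
  - by apply: nearW => j; exact: Omx_.
  - apply: cvg_inv_succ => j /=; have [_ a2 aj _] := aP j.
    by rewrite subr0 gtr0_norm.
have [j [uj /(diff_quotientE _ _ _ (a0 j)) Oj]] :=
  filter_ex (filterI (near_ball_seq uw e0) uO).
by have [_ _ _ far_j] := aP j; exact: (far_j _ (ltW uj)).
Unshelve. all: by end_near. Qed.

Variable B : V -> V -> R.
Hypothesis B_cvg : forall (x_ y_ : nat -> V) x y, x_ @ \oo --> x -> y_ @ \oo --> y ->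
  B (x_ k) (y_ k) @[k --> \oo] --> B x y.

Lemma normal_cone_le0 v w : normal_cone B Om x v -> regular_tangent_cone Om x w -> B v w <= 0.
Proof.
move=> [x_ [v_ [xx vv Omx_ Nv]]] Tw.
have /choice[a aP] j : exists kw : nat * V, [/\ (j <= kw.1)%N,
    tangent_cone Om (x_ kw.1) kw.2 & `|kw.2 - w| <= harmonic j].
  have [N _ hN] := regular_tangent_liminf xx Omx_ Tw (harmonic_gt0 j).
  have [w' Tw' ww'] := hN (N + j)%N (leq_addr _ _).
  by exists ((N + j)%N, w'); split=> //=; exact: leq_addl.
have fst_oo : (fun j => (a j).1) @ \oo --> \oo.
  apply/cvgnyPge => A; near=> j; apply: (@leq_trans j); last by have [] := aP j.
  by near: j; exact: nbhs_infty_ge.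
have Bvw : B (v_ (a j).1) (a j).2 @[j --> \oo] --> B v w.
  apply: (B_cvg (x_ := fun j => v_ (a j).1)); first exact: cvg_comp fst_oo vv.
  by apply: cvg_inv_succ => j; have [] := aP j.
by apply: cvgr_to_le Bvw _; apply: nearW => j; apply: Nv; have [] := aP j.
Unshelve. all: by end_near. Qed.

(** At a point of strict smoothness the frozen sequence already produces every limiting
    normal, since the tangent cone there is the regular tangent cone. *)
Lemma normal_cone_strict : Om x ->
  regular_tangent_cone Om x = paratingent_cone Om x ->
  normal_cone B Om x = polar B (regular_tangent_cone Om x).
Proof.
move=> Omx strict; apply/seteqP; split=> v; first by move=> Nv w; exact: normal_cone_le0.
move=> vT; exists (fun=> x), (fun=> v); split=> //; try exact: cvg_cst.
by move=> _ w; rewrite tangent_cone_strict //; exact: vT.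
Qed.

End NormalCone.
End Cones.

Section ProductSpace.
Context {R : realType} {X : normedVectType R} {dot : {dot X for idfun}}.
Hypothesis dot_norm : induces_norm dot.

Lemma cvg_prod_dot (p_ q_ : nat -> X * X) p q : p_ @ \oo --> p -> q_ @ \oo --> q ->
  prod_dot dot dot (p_ k) (q_ k) @[k --> \oo] --> prod_dot dot dot p q.
Proof.
case: p q => [p1 p2] [q1 q2] /cvg_prodP[a1 a2] /cvg_prodP[b1 b2].
by apply: cvgD; apply: (cvg_dot dot_norm).
Qed.

Lemma bounded_subseq_prod (p_ : nat -> X * X) (M : R) : (forall k, `|p_ k| <= M) ->
  exists2 phi : nat -> nat, phi @ \oo --> \oo & exists l : X * X, (p_ \o phi) @ \oo --> l.
Proof.
move=> bp.
have b1 k : `|(p_ k).1| <= M by apply: le_trans (bp k); rewrite prod_normE le_max lexx.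
have b2 k : `|(p_ k).2| <= M by apply: le_trans (bp k); rewrite prod_normE le_max lexx orbT.
have [f foo [l1 fl1]] := bounded_subseq dot_norm b1.
have [g goo [l2 gl2]] := bounded_subseq dot_norm (fun k => b2 (f k)).
exists (f \o g); first exact: cvg_comp goo foo.
exists (l1, l2); apply/cvg_prodP; split; last exact: gl2.
exact: cvg_comp goo fl1.
Qed.

End ProductSpace.

(** * Second subderivatives *)

Section SecondSubderivative.
Context {R : realType} {X : normedVectType R} {dot : {dot X for idfun}}.
Variables (f : X -> \bar R) (xbar vbar : X).

Let quot2 (t : R) (u : X) : \bar R :=
  ((f (xbar + t *: u)%R - f xbar - (t * dot vbar u)%:E) * ((2^-1 * t ^+ 2)^-1)%:E)%E.

(** The filter has a countable base: a lower bound failing on every member of the filter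
    fails along a sequence. *)
Lemma second_subderivative_ge (w : X) (b : R) :
  (forall (t_ : nat -> R) (w_ : nat -> X), (forall k, 0 < t_ k) -> t_ @ \oo --> (0 : R) ->
    w_ @ \oo --> w -> forall a : R, a < b ->
    \forall k \near \oo, (a%:E <= quot2 (t_ k) (w_ k))%E) ->
  (b%:E <= second_subderivative dot f xbar vbar w)%E.
Proof.
move=> h; apply/lee_subgt0Pr => d d0; rewrite -EFinB.
have ab : b - d < b by rewrite gtrDl oppr_lt0.
move: (b - d) ab => a ab; rewrite /second_subderivative limf_einfE.
suff [V FV aV] : exists2 V : set (R * X), filter_prod 0^'+ (nbhs w) V &
    forall p, V p -> (a%:E <= quot2 p.1 p.2)%E.
  apply: (@le_trans _ _ (ereal_inf ((fun p => quot2 p.1 p.2) @` V))).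
    by apply: le_ereal_inf_tmp => _ [p Vp <-]; exact: aV.
  by apply: ereal_sup_ubound; exists V.
apply: contrapT => /forall2NP neg.
have /choice[p pP] k : exists p : R * X,
    [/\ 0 < p.1, p.1 <= harmonic k, `|p.2 - w| <= harmonic k & (quot2 p.1 p.2 < a%:E)%E].
  have h0 := harmonic_gt0 k : 0 < harmonic k :> R.
  have [[]|] := neg [set p : R * X | [/\ 0 < p.1, p.1 <= harmonic k & `|p.2 - w| <= harmonic k]].
    exists ([set t | 0 < t <= harmonic k], [set u | `|u - w| <= harmonic k]);
      last by move=> [t u] /= [/andP[t1 t2] u1]; split.
    split=> /=.
    - near=> t => /=; apply/andP; split; first by near: t; exact: nbhs_right_gt.
      by near: t; exact: nbhs_right_le.
    - near=> u => /=; rewrite distrC; near: u; exact: cvgr_dist_le.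
  move=> /existsNP[q] /not_implyP[[q1 q2 q3] /negP]; rewrite -ltNge => q4.
  by exists q.
have t0 k : 0 < (p k).1 by have [] := pP k.
have tt : (p k).1 @[k --> \oo] --> (0 : R).
  by apply: cvg_inv_succ => k; rewrite subr0 gtr0_norm //; have [] := pP k.
have ww : (p k).2 @[k --> \oo] --> w by apply: cvg_inv_succ => k; have [] := pP k.
have [k ak] := filter_ex (h _ _ t0 tt ww a ab).
have [_ _ _] := pP k; rewrite ltNge; apply/negP; rewrite negbK; exact: ak.
Unshelve. all: by end_near. Qed.

Lemma second_subderivative_le (t_ : nat -> R) (w_ : nat -> X) (w : X) (b : R) :
  (forall k, 0 < t_ k) -> t_ @ \oo --> (0 : R) -> w_ @ \oo --> w ->
  quot2 (t_ k) (w_ k) @[k --> \oo] --> b%:E ->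
  (second_subderivative dot f xbar vbar w <= b%:E)%E.
Proof.
move=> t0 tt ww qb; rewrite /second_subderivative limf_einfE.
apply: ge_ereal_sup => _ [V FV <-].
have tw : (fun k => (t_ k, w_ k)) @ \oo --> filter_prod 0^'+ (nbhs w).
  by apply/cvg_filter_prod; split=> //; apply/cvg_at_right0P; split=> //; exact: nearW.
have Vk : \forall k \near \oo, V (t_ k, w_ k) := tw _ FV.
apply: cvge_ge qb; apply: filterS Vk => k Vk; apply: ereal_inf_lbound.
by exists (t_ k, w_ k).
Qed.

End SecondSubderivative.

(** * Second-order expansion of a prox-regular function along its subdifferential *)

Section ProxRegular.
Context {R : realType} {X : normedVectType R} {dot : {dot X for idfun}}.
Hypothesis dot_norm : induces_norm dot.
Variables (f : X -> \bar R) (xbar vbar : X) (eps r : R).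
Hypotheses (eps_gt0 : 0 < eps) (r_ge0 : 0 <= r).
Hypothesis vbar_sub : subdifferential dot f xbar vbar.
Hypothesis f_cont : subdifferentially_continuous dot f xbar vbar.
Hypothesis prox : forall x v : X, subdifferential dot f x v ->
  Num.sqrt (`|x - xbar| ^+ 2 + `|v - vbar| ^+ 2) <= eps ->
  (f x < f xbar + eps%:E)%E ->
  forall x' : X, `|x' - xbar| <= eps ->
    (f x + (dot v (x' - x) - r / 2 * `|x' - x| ^+ 2)%:E <= f x')%E.

Let f_fin x v : subdifferential dot f x v -> f x = (fine (f x))%:E.
Proof. by case=> fx _; rewrite fineK. Qed.

Lemma prox_at_base x' : `|x' - xbar| <= eps ->
  (f xbar + (dot vbar (x' - xbar) - r / 2 * `|x' - xbar| ^+ 2)%:E <= f x')%E.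
Proof.
apply: prox => //; first by rewrite !subrr !normr0 expr0n addr0 sqrtr0 ltW.
by rewrite (f_fin vbar_sub) -EFinD lte_fin ltrDl.
Qed.

Lemma prox_near (x_ v_ : nat -> X) : x_ @ \oo --> xbar -> v_ @ \oo --> vbar ->
  (forall k, subdifferential dot f (x_ k) (v_ k)) ->
  \forall k \near \oo, forall x' : X, `|x' - xbar| <= eps ->
    (f (x_ k) + (dot (v_ k) (x' - x_ k) - r / 2 * `|x' - x_ k| ^+ 2)%:E <= f x')%E.
Proof.
move=> xx vv xv.
have dist0 : `|x_ k - xbar| ^+ 2 + `|v_ k - vbar| ^+ 2 @[k --> \oo] --> (0 : R).
  have sq0 (a : nat -> X) l : a @ \oo --> l -> `|a k - l| ^+ 2 @[k --> \oo] --> (0 : R).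
    move=> al; rewrite (_ : 0 = `|l - l| ^+ 2); last by rewrite subrr normr0 expr0n.
    by apply: cvg_sq_norm; apply: cvgB => //; exact: cvg_cst.
  by rewrite -(addr0 (0 : R)); apply: cvgD; exact: sq0.
have fx : fine (f (x_ k)) @[k --> \oo] --> fine (f xbar).
  by apply: fine_cvg; rewrite -(f_fin vbar_sub); exact: f_cont xv.
have h1 : \forall k \near \oo, `|x_ k - xbar| ^+ 2 + `|v_ k - vbar| ^+ 2 <= eps ^+ 2.
  by apply: cvgr_le dist0 _ _; rewrite exprn_gt0.
have h2 : \forall k \near \oo, fine (f (x_ k)) < fine (f xbar) + eps.
  by apply: cvgr_lt fx _ _; rewrite ltrDl.
apply: filterS2 h1 h2 => k h1 h2; apply: prox => //.
- by rewrite -(ger0_norm (ltW eps_gt0)) -sqrtr_sqr ler_wsqrtr.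
- by rewrite (f_fin (xv k)) (f_fin vbar_sub) -EFinD lte_fin.
Qed.

(** The step lengths are prescribed, so that graph points leaving (xbar, vbar) in different
    directions can be compared at the same scale. *)
Definition graph_seq (t_ : nat -> R) (w e : X) (w_ e_ : nat -> X) : Prop :=
  [/\ w_ @ \oo --> w, e_ @ \oo --> e &
    forall k, subdifferential dot f (xbar + t_ k *: w_ k) (vbar + t_ k *: e_ k)].

(** Half of the second-order difference quotient at xbar for vbar. *)
Definition quot (t : R) (u : X) : R :=
  (fine (f (xbar + t *: u)) - fine (f xbar) - t * dot vbar u) / t ^+ 2.

Section Expansion.
Variable t_ : nat -> R.
Hypotheses (t_gt0 : forall k, 0 < t_ k) (t_0 : t_ @ \oo --> (0 : R)).

Lemma quotK u v k : subdifferential dot f (xbar + t_ k *: u) v ->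
  f (xbar + t_ k *: u) = (fine (f xbar) + t_ k * dot vbar u + t_ k ^+ 2 * quot (t_ k) u)%:E.
Proof.
move=> /f_fin ->; congr EFin; rewrite /quot (mulrC (t_ k ^+ 2)) divfK ?expf_neq0 ?gt_eqF //; ring.
Qed.

(** Prox-regularity at the graph point with directions (w_ k, e_ k): after subtracting the
    affine part at xbar, all remaining terms are of order t_ k ^+ 2. *)
Lemma prox_quot (w e u : X) w_ e_ u_ : graph_seq t_ w e w_ e_ -> u_ @ \oo --> u ->
  \forall k \near \oo,
    ((fine (f xbar) + t_ k * dot vbar (u_ k) + t_ k ^+ 2 *
       (quot (t_ k) (w_ k) + dot (e_ k) (u_ k - w_ k) - r / 2 * `|u_ k - w_ k| ^+ 2))%:E
     <= f (xbar + t_ k *: u_ k)%R)%E.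
Proof.
move=> [ww ee sub] uu.
have near_x := near_ball_seq (cvg_step (x := xbar) t_0 uu) eps_gt0.
have near_p := prox_near (cvg_step t_0 ww) (cvg_step t_0 ee) sub.
apply: filterS2 near_x near_p => k ux /(_ _ (ltW ux)).
apply: le_trans; rewrite (quotK (sub k)) -EFinD lee_fin.
have -> : xbar + t_ k *: u_ k - (xbar + t_ k *: w_ k) = t_ k *: (u_ k - w_ k).
  by rewrite opprD addrACA subrr add0r -scalerBr.
rewrite normrZ (gtr0_norm (t_gt0 k)) exprMn dotZr dotDl dotZl !dotE.
by rewrite le_eqVlt; apply/orP; left; apply/eqP; ring.
Qed.

Lemma prox_quot_graph (w e u z : X) w_ e_ u_ z_ :
  graph_seq t_ w e w_ e_ -> graph_seq t_ u z u_ z_ ->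
  \forall k \near \oo, quot (t_ k) (w_ k) + dot (e_ k) (u_ k - w_ k)
     - r / 2 * `|u_ k - w_ k| ^+ 2 <= quot (t_ k) (u_ k).
Proof.
move=> gw gu; have [uu _ sub] := gu; apply: filterS (prox_quot gw uu) => k.
by rewrite (quotK (sub k)) lee_fin lerD2l ler_pM2l // exprn_gt0.
Qed.

Lemma prox_defect_cvg (w e u : X) (w_ e_ u_ : nat -> X) :
  w_ @ \oo --> w -> e_ @ \oo --> e -> u_ @ \oo --> u ->
  dot (e_ k) (u_ k - w_ k) - r / 2 * `|u_ k - w_ k| ^+ 2 @[k --> \oo] -->
  dot e (u - w) - r / 2 * `|u - w| ^+ 2.
Proof.
move=> ww ee uu; have uw : u_ k - w_ k @[k --> \oo] --> u - w by exact: cvgB.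
apply: cvgB; first exact: cvg_dot.
by apply: cvgMl_tmp; exact: cvg_sq_norm.
Qed.

Variable L : set (X * X).
Hypothesis L_linear : linear_set L.
Hypothesis L_reach : forall w e, L (w, e) -> exists w_ e_, graph_seq t_ w e w_ e_.

(** At the points s (w, e) of a segment of L, the prox inequalities between the parameters
    a and b show that quot - s^2 <e, w> / 2 varies by at most a multiple of (b - a)^2, in
    the limit; subdividing [0, 1] into N pieces leaves a total error of order 1 / N. *)
Lemma quot_cvg w e w_ e_ : L (w, e) -> graph_seq t_ w e w_ e_ ->
  quot (t_ k) (w_ k) @[k --> \oo] --> dot e w / 2.
Proof.
move=> Lwe gwe.
(* C bounds the coefficient of (b - a) ^+ 2 in the error of step *)
pose c := dot e w; pose C := (`|c| + r * `|w| ^+ 2) / 2.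
have C0 : 0 <= C by rewrite divr_ge0 // addr_ge0 // mulr_ge0 // exprn_ge0.
have step a b u_ z_ u'_ z'_ (d : R) : 0 < d ->
  graph_seq t_ (a *: w) (a *: e) u_ z_ -> graph_seq t_ (b *: w) (b *: e) u'_ z'_ ->
  \forall k \near \oo, (quot (t_ k) (u_ k) - a ^+ 2 * c / 2) - C * (b - a) ^+ 2 - d <=
     quot (t_ k) (u'_ k) - b ^+ 2 * c / 2.
  move=> d0 ga gb; have [ua za _] := ga; have [ub _ _] := gb.
  have := cvgr_ge _ (prox_defect_cvg ua za ub).
  move=> /(_ _ (a * (b - a) * c - r / 2 * ((b - a) ^+ 2 * `|w| ^+ 2) - d)) lim.
  have {}lim : \forall k \near \oo, a * (b - a) * c - r / 2 * ((b - a) ^+ 2 * `|w| ^+ 2) - d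
      <= dot (z_ k) (u'_ k - u_ k) - r / 2 * `|u'_ k - u_ k| ^+ 2.
    apply: lim; rewrite -scalerBl normrZ exprMn real_normK ?num_real // dotZl dotZr.
    by rewrite -mulrA gtrDl oppr_lt0.
  apply: filterS2 lim (prox_quot_graph ga gb) => k h1 h2.
  have h3 : - C * (b - a) ^+ 2 <= - (c / 2 + r / 2 * `|w| ^+ 2) * (b - a) ^+ 2.
    rewrite ler_wpM2r ?sqr_ge0 // lerN2 /C mulrDl mulrAC lerD2r ler_pM2r //.
    exact: ler_norm.
  nra.
have bound N i : forall u_ z_ (d : R), 0 < d ->
    graph_seq t_ ((i%:R / N.+1%:R) *: w) ((i%:R / N.+1%:R) *: e) u_ z_ ->
  \forall k \near \oo,
    `|quot (t_ k) (u_ k) - (i%:R / N.+1%:R) ^+ 2 * c / 2| <= i%:R * (C / N.+1%:R ^+ 2) + d.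
  elim: i => [|i IH] u_ z_ d d0 g.
    have g0 : graph_seq t_ (0 *: w) (0 *: e) (fun=> 0) (fun=> 0).
      split; try (by rewrite scale0r; exact: cvg_cst).
      by move=> k; rewrite !scaler0 !addr0.
    rewrite mul0r in g *; have := step 0 0 _ _ _ _ _ d0 g g0.
    apply: filterS2 (step 0 0 _ _ _ _ _ d0 g0 g) => k /=.
    have -> : quot (t_ k) 0 = 0.
      by rewrite /quot scaler0 addr0 subrr dot0r mulr0 subrr mul0r.
    rewrite subrr expr0n /= mulr0 !mul0r !subr0 ler_norml => h1 h2.
    by apply/andP; split; lra.
  have [] := @L_reach ((i%:R / N.+1%:R) *: w) ((i%:R / N.+1%:R) *: e).
    exact: (linear_setZ (i%:R / N.+1%:R) L_linear Lwe).
  move=> u'_ [z'_ g']; have d2 : 0 < d / 2 by rewrite divr_gt0.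
  have := step _ _ _ _ _ _ _ d2 g g'.
  apply: filterS3 (step _ _ _ _ _ _ _ d2 g' g) (IH _ _ _ d2 g') => k.
  have -> : (i.+1%:R / N.+1%:R - i%:R / N.+1%:R : R) = N.+1%:R^-1.
    by rewrite -mulrBl -natrB ?subSn // subnn mul1r.
  have -> : (i%:R / N.+1%:R - i.+1%:R / N.+1%:R : R) = - N.+1%:R^-1.
    by rewrite -mulrBl -opprB -natrB ?subSn // subnn mulN1r.
  rewrite sqrrN exprVn !ler_norml => h1 /andP[h2 h3] h4.
  have -> : i.+1%:R * (C / N.+1%:R ^+ 2) = i%:R * (C / N.+1%:R ^+ 2) + C / N.+1%:R ^+ 2.
    by rewrite -(natr1 i) mulrDl mul1r.
  move: h1 h2 h3 h4; set m := i%:R * _; set m1 := C / _; set s1 := _ * c / 2.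
  set s2 := _ * c / 2 => *.
  by apply/andP; split; lra.
apply/cvgrPdist_le => d d0.
have [N CN] : exists N : nat, C / N.+1%:R <= d / 2.
  have C1 : 0 < C + 1 by rewrite ltr_wpDl.
  have [|N] := @ltr_add_invr R 0 (d / 2 / (C + 1)); first by rewrite !divr_gt0.
  rewrite add0r ltr_pdivlMr // => /ltW hN; exists N; apply: le_trans hN.
  by rewrite mulrC ler_wpM2l ?invr_ge0 // lerDl.
have [g1 g2 g3] := gwe; have d2 : 0 < d / 2 by rewrite divr_gt0.
have := bound N N.+1 w_ e_ _ d2; rewrite divff // !scale1r expr1n mul1r => /(_ gwe).
apply: filterS => k; rewrite distrC -/c => h; apply: (le_trans h).
rewrite exprS invfM mulrCA [X in C * X]mulrA mulfV // mul1r expr1.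
by rewrite [leRHS](_ : d = d / 2 + d / 2) ?lerD2r //; field.
Qed.

(** Both sides of prox_quot_graph converge, by quot_cvg. *)
Lemma prox_limit w e u z : L (w, e) -> L (u, z) ->
  dot e w / 2 + (dot e (u - w) - r / 2 * `|u - w| ^+ 2) <= dot z u / 2.
Proof.
move=> Lwe Luz.
have [w_ [e_ gw]] := L_reach Lwe; have [u_ [z_ gu]] := L_reach Luz.
have [ww ee _] := gw; have [uu _ _] := gu.
apply: ler_cvg_to (cvgD (quot_cvg Lwe gw) (prox_defect_cvg ww ee uu)) (quot_cvg Luz gu) _.
by apply: filterS (prox_quot_graph gw gu) => k; rewrite !fctE addrA.
Qed.

(** To first order in s, prox_limit between (w, e) and (w + s u, e + s z) reads
    <e, u> <= (<e, u> + <z, w>) / 2, and the two pairs can be exchanged. *)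
Lemma graph_isotropic w e u z : L (w, e) -> L (u, z) -> dot e u = dot z w.
Proof.
have half : forall w e u z, L (w, e) -> L (u, z) -> dot e u <= dot z w.
  move=> {}w {}e {}u {}z Lwe Luz; rewrite leNgt; apply/negP => lt.
  pose a := dot e u - dot z w; pose b := dot z u + r * `|u| ^+ 2.
  have a0 : 0 < a by rewrite subr_gt0.
  (* b / 2 is the coefficient of s ^+ 2, and s = a / (|b| + 1) makes s b < a *)
  have s0 : 0 < a / (`|b| + 1) by rewrite divr_gt0 // ltr_wpDl.
  have := prox_limit Lwe (L_linear.2 (a / (`|b| + 1)) _ _ Luz Lwe).
  move: (a / _) (divfK (lt0r_neq0 (ltr_wpDl (normr_ge0 b) ltr01)) a) s0 => s sE s0.
  rewrite addrK normrZ exprMn real_normK ?num_real // !dotE => h.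
  have bb := ler_norm b.
  have : s * a <= s * (s * b) by rewrite /a /b; lra.
  rewrite ler_pM2l // => h'.
  have : `|b| + 1 <= b by rewrite -(ler_pM2l s0) sE.
  lra.
by move=> Lwe Luz; apply/eqP; rewrite eq_le !half.
Qed.

End Expansion.
Section SecondOrder.
Variable L : set (X * X).
Hypothesis L_linear : linear_set L.
Hypothesis L_reach : forall t_ : nat -> R, (forall k, 0 < t_ k) -> t_ @ \oo --> (0 : R) ->
  forall w e, L (w, e) -> exists w_ e_, graph_seq t_ w e w_ e_.

(** Comparing with graph points in the direction (u, z) by prox_quot bounds the quotients at
    w from below, up to a defect that vanishes for u = w. *)
Lemma second_subderivative_prox_ge (u z w : X) : L (u, z) ->
  ((dot z u + 2 * dot z (w - u) - r * `|w - u| ^+ 2)%:E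
     <= second_subderivative dot f xbar vbar w)%E.
Proof.
move=> Luz; apply: second_subderivative_ge => t_ w_ t0 tt ww a ab.
have [u_ [z_ g]] := L_reach t0 tt Luz; have [uu zz _] := g.
have lim : quot (t_ k) (u_ k)
    + (dot (z_ k) (w_ k - u_ k) - r / 2 * `|w_ k - u_ k| ^+ 2) @[k --> \oo] -->
    dot z u / 2 + (dot z (w - u) - r / 2 * `|w - u| ^+ 2).
  exact: cvgD (quot_cvg t0 tt L_linear (L_reach t0 tt) Luz g)
    (prox_defect_cvg uu zz ww).
have a2 : a / 2 < dot z u / 2 + (dot z (w - u) - r / 2 * `|w - u| ^+ 2) by lra.
have fx := fineK (vbar_sub.1).
have ev1 := cvgr_ge _ lim _ a2.
have ev2 := prox_quot t0 tt g ww.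
apply: filterS2 (ev1 _) ev2 => k.
rewrite addrA; set Q := quot _ _ + _ - _ => aQ.
rewrite -fx; case: (f (xbar + _)) => [s||//]; last first.
  move=> _; rewrite /= gt0_mulye ?leey // lte_fin invr_gt0 mulr_gt0 ?invr_gt0 //.
  exact: exprn_gt0.
rewrite lee_fin => h; rewrite -!EFinB -EFinM lee_fin ler_pdivlMr ?mulr_gt0 ?invr_gt0 ?exprn_gt0 //.
have : t_ k ^+ 2 * (a / 2) <= t_ k ^+ 2 * Q by rewrite ler_wpM2l // exprn_ge0 // ltW.
lra.
Qed.

(** The previous bound with u = w is attained along a graph sequence. *)
Lemma second_subderivative_graph w e : L (w, e) ->
  second_subderivative dot f xbar vbar w = (dot e w)%:E.
Proof.
move=> Lwe; apply/eqP; rewrite eq_le; apply/andP; split; last first.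
  have := second_subderivative_prox_ge w Lwe.
  by rewrite subrr dot0r normr0 expr0n /= !mulr0 subr0 addr0.
have [w_ [e_ g]] := L_reach harmonic_gt0 cvg_harmonic Lwe; have [ww _ sub] := g.
apply: (second_subderivative_le harmonic_gt0 cvg_harmonic ww).
have lim := quot_cvg harmonic_gt0 cvg_harmonic L_linear
  (L_reach harmonic_gt0 cvg_harmonic) Lwe g.
have -> : dot e w = 2 * (dot e w / 2) by field.
rewrite (_ : (fun k => _) =
    EFin \o (fun k => 2 * quot (harmonic k) (w_ k))).
  by apply: cvg_comp; [exact: cvgMl_tmp lim | exact: cvg_id].
apply/funext => k; rewrite [RHS]/comp -(fineK (sub k).1) -(fineK vbar_sub.1) -!EFinB -EFinM.
congr EFin; rewrite /quot.
move: (harmonic k) (harmonic_gt0 k : 0 < harmonic k :> R) => s /lt0r_neq0 s0.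
by field.
Qed.

(** Outside the domain of L, the component y of w orthogonal to it satisfies (0, c y) in L
    for all c: these vertical directions give lower bounds growing linearly in c. *)
Lemma second_subderivative_off_dom w :
  (forall z, (forall y, rel_dom L y -> dot z y = 0) -> L (0, z)) ->
  ~ rel_dom L w -> second_subderivative dot f xbar vbar w = +oo%E.
Proof.
move=> Lorth Lw; have Kl := rel_dom_linear L_linear.
have [k Kk wk] := linear_set_projection (dot := dot) w Kl.
have y0 : w - k != 0 by apply/negP; rewrite subr_eq0 => /eqP wE; apply: Lw; rewrite wE.
have yw : dot (w - k) w = dot (w - k) (w - k) by rewrite [RHS]dotBr (wk _ Kk) subr0.
have yy := dot_gt0 (dot := dot) y0.
apply/eqyP => M _.
(* makes the lower bound 2 c <w - k, w> - r |w|^2 equal to M *)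
pose c := (M + r * `|w| ^+ 2) / (2 * dot (w - k) (w - k)).
have Lc : L (0, c *: (w - k)).
  by apply: Lorth => y Ky; rewrite dotZl wk // mulr0.
apply: le_trans (second_subderivative_prox_ge w Lc); rewrite lee_fin subr0 dot0r add0r.
rewrite dotZl yw /c; move: (dot _ _) (lt0r_neq0 yy) => q q0.
by rewrite le_eqVlt; apply/orP; left; apply/eqP; field.
Qed.

End SecondOrder.
End ProxRegular.

(** * Existence of subgradients in prescribed directions *)

Section Surjectivity.
Context {R : realType} {X : normedVectType R} {dot : {dot X for idfun}}.
Hypothesis dot_norm : induces_norm dot.
Variable f : X -> \bar R.

(** A local quadratic minorant with slope v at x forces f-epigraph tangents (u, b) to
    satisfy b >= <v, u>. *)
Lemma proximal_subdifferential x v (mu d : R) : f x \is a fin_num -> 0 < d ->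
  (forall x', `|x' - x| < d ->
    (f x + (dot v (x' - x) - mu / 2 * `|x' - x| ^+ 2)%:E <= f x')%E) ->
  subdifferential dot f x v.
Proof.
move=> fx d0 minor; split=> //.
exists (fun=> (x, fine (f x))), (fun=> (v, -1)); split; try exact: cvg_cst.
  by move=> _; rewrite /epi /= fineK.
move=> _ [u b] /tangent_coneE[t [ub [/cvg_at_right0P[tt t0] /cvg_prodP[uu bb] epi_k]]].
rewrite /prod_dot /= mulN1r subr_le0.
have step : x + t k *: (ub k).1 @[k --> \oo] --> x := cvg_step tt uu.
have lim : dot v (ub k).1 - mu / 2 * (t k * `|(ub k).1| ^+ 2) @[k --> \oo] --> dot v u.
  rewrite -[X in _ --> X]subr0 -(mulr0 (mu / 2)) -(mul0r (`|u| ^+ 2)).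
  apply: cvgB; first by apply: (cvg_dot dot_norm) => //; exact: cvg_cst.
  by apply: cvgMl_tmp; apply: cvgM => //; exact: cvg_sq_norm.
apply: ler_cvg_to lim bb _; apply: filterS2 t0 (near_ball_seq step d0) => k tk xk.
have := epi_k k; rewrite /epi /= => /(le_trans (minor _ xk)).
rewrite -{1}(fineK fx) -EFinD lee_fin lerD2l [x + _]addrC addrK.
rewrite normrZ gtr0_norm // dotZr exprMn => h.
rewrite -(ler_pM2l tk); apply: le_trans h.
by rewrite le_eqVlt; apply/orP; left; apply/eqP; ring.
Qed.

Variables (xbar vbar : X) (eps eps0 r : R).
Hypotheses (eps_gt0 : 0 < eps) (eps0_gt0 : 0 < eps0) (r_ge0 : 0 <= r).
Hypothesis fxbar : f xbar \is a fin_num.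
Hypothesis lsc : forall a : R, (a%:E <= f xbar + eps0%:E)%E ->
  closed [set x | `|x - xbar| <= eps0 /\ (f x <= a%:E)%E].
Hypothesis minor : forall x', `|x' - xbar| <= eps ->
  (f xbar + (dot vbar (x' - xbar) - r / 2 * `|x' - xbar| ^+ 2)%:E <= f x')%E.

(** Minimising sequences of f minus a quadratic function vanishing at xbar have bounded
    terms, and on a small ball the values of f along them stay below the level up to which
    f is lower semicontinuous. *)
Lemma tilted_minimum (p : X) (mu d : R) : 0 <= mu -> 0 < d -> d <= eps -> d <= eps0 ->
  `|p| * d < eps0 ->
  let h x := dot p (x - xbar) - mu / 2 * `|x - xbar| ^+ 2 in
  exists x, [/\ `|x - xbar| <= d, f x \is a fin_num &
    forall x', `|x' - xbar| <= d -> (f x + (h x' - h x)%:E <= f x')%E].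
Proof.
move=> mu0 d0 deps deps0 pd h.
have sq x : `|x - xbar| <= d -> `|x - xbar| ^+ 2 <= d ^+ 2.
  by move=> xd; rewrite ler_sqr ?nnegrE // ltW.
have dotd q x : `|x - xbar| <= d -> `|dot q (x - xbar)| <= `|q| * d.
  by move=> xd; rewrite (le_trans (cauchy_schwarz dot_norm _ _)) // ler_wpM2l.
have h_le x : `|x - xbar| <= d -> h x <= `|p| * d.
  move=> xd; rewrite lerBlDr ler_wpDr ?mulr_ge0 ?divr_ge0 ?exprn_ge0 //.
  exact: le_trans (ler_norm _) (dotd _ _ xd).
have h0 : h xbar = 0 by rewrite /h subrr dot0r normr0 expr0n mulr0 subrr.
(* the real numbers lying above f - h somewhere on the ball *)
pose S := [set y : R | exists2 x, `|x - xbar| <= d & (f x <= (y + h x)%:E)%E].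
have S0 : S (fine (f xbar)).
  by exists xbar; rewrite ?h0 ?addr0 ?fineK // subrr normr0 ltW.
have Slb : has_inf S.
  split; first by exists (fine (f xbar)).
  exists (fine (f xbar) - `|vbar| * d - r / 2 * d ^+ 2 - `|p| * d) => y [x xd fy].
  have := le_trans (minor (le_trans xd deps)) fy.
  rewrite -{1}(fineK fxbar) -EFinD lee_fin => le1.
  have := h_le x xd; have := dotd vbar x xd; rewrite ler_norml => /andP[le2 _] le3.
  have : r / 2 * `|x - xbar| ^+ 2 <= r / 2 * d ^+ 2.
    by rewrite ler_wpM2l ?divr_ge0 // sq.
  lra.
set m := inf S.
have m_le : m <= fine (f xbar) by apply: ge_inf => //; exact: Slb.2.
have /choice[x_ xP] j : exists x, `|x - xbar| <= d /\ (f x <= (m + harmonic j + h x)%:E)%E.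
  have [y [x xd fy] ym] := inf_adherent (harmonic_gt0 j) Slb.
  by exists x; split=> //; apply: (le_trans fy); rewrite lee_fin lerD2r ltW.
have bx j : `|x_ j| <= d + `|xbar|.
  by rewrite -[x_ j](subrK xbar) (le_trans (ler_normD _ _)) // lerD2r (xP j).1.
have [phi phioo [x xx]] := bounded_subseq dot_norm bx.
have xbx : (x_ \o phi) j - xbar @[j --> \oo] --> x - xbar.
  by apply: cvgB => //; exact: cvg_cst.
have xd : `|x - xbar| <= d.
  by apply: cvgr_to_le (cvg_norm xbx) _; apply: nearW => j; exact: (xP _).1.
have hx : m + harmonic (phi j) + h ((x_ \o phi) j) @[j --> \oo] --> m + h x.
  rewrite -{2}[m]addr0; apply: cvgD.
    apply: cvgD; first exact: cvg_cst.
    exact: cvg_comp phioo cvg_harmonic.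
  apply: cvgB; first by apply: (cvg_dot dot_norm) => //; exact: cvg_cst.
  by apply: cvgMl_tmp; exact: cvg_sq_norm.
have fx_le : (f x <= (m + h x)%:E)%E.
  apply/lee_addgt0Pr => e e0.
  have gap : m + h x < fine (f xbar) + eps0.
    by rewrite ler_ltD // (le_lt_trans (h_le _ xd)).
  pose a := Num.min (m + h x + e) (fine (f xbar) + eps0).
  have ma : m + h x < a by rewrite lt_min gap ltrDl e0.
  have cl : closed [set x | `|x - xbar| <= eps0 /\ (f x <= a%:E)%E].
    by apply: lsc; rewrite -(fineK fxbar) -EFinD lee_fin ge_min lexx orbT.
  suff [_ fa] : `|x - xbar| <= eps0 /\ (f x <= a%:E)%E.
    by apply: le_trans fa _; rewrite -EFinD lee_fin ge_min lexx.
  apply: (@closed_cvg nat X \oo _ (x_ \o phi) _ cl _ x xx).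
  apply: filterS (cvgr_le _ hx _ ma) => j hj; split.
    exact: le_trans (xP _).1 deps0.
  by apply: le_trans (xP _).2 _; rewrite lee_fin.
have m_min x' : `|x' - xbar| <= d -> ((m + h x')%:E <= f x')%E.
  move=> x'd; have := minor (le_trans x'd deps).
  rewrite -(fineK fxbar) -EFinD; case E : (f x') => [s||] //; last by rewrite !leey.
  move=> _; rewrite lee_fin -lerBrDr; apply: ge_inf; first exact: Slb.2.
  by exists x' => //; rewrite E subrK.
have fxE : f x = (m + h x)%:E by apply/eqP; rewrite eq_le fx_le m_min.
exists x; split=> //; first by rewrite fxE.
move=> x' /m_min; apply: le_trans; rewrite fxE -EFinD lee_fin.
by rewrite le_eqVlt; apply/orP; left; apply/eqP; ring.
Qed.

(** The solution of e + (r + 1) w = z is found by minimising f tilted by vbar + t z and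
    convexified by (r + 1) / 2 |. - xbar|^2: as r + 1 exceeds the prox constant r by one,
    the minimiser is at distance at most 2 t |z| from xbar. *)
Lemma subdifferential_step z : exists2 t0 : R, 0 < t0 & forall t, 0 < t -> t <= t0 ->
  exists2 w, `|w| <= 2 * `|z| &
    subdifferential dot f (xbar + t *: w) (vbar + t *: (z - (r + 1) *: w)).
Proof.
(* P bounds |vbar + t z| for t <= 1, and d is chosen so that P * d < eps0 *)
pose P := `|vbar| + `|z| + 1.
have P0 : 0 < P by rewrite ltr_wpDl // addr_ge0.
pose d := Num.min (Num.min eps eps0) (eps0 / (2 * P)).
have d0 : 0 < d by rewrite !lt_min eps_gt0 eps0_gt0 divr_gt0 // mulr_gt0.
have deps : d <= eps by rewrite !ge_min lexx.
have deps0 : d <= eps0 by rewrite !ge_min lexx orbT.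
have dP : P * d < eps0.
  have : d <= eps0 / (2 * P) by rewrite ge_min lexx orbT.
  rewrite ler_pdivlMr ?mulr_gt0 // => le1; nra.
(* for t below this bound 2 t |z| < d, which keeps the minimiser inside the ball *)
have t0 : 0 < Num.min 1 (d / (2 * (2 * `|z| + 1))).
  by rewrite lt_min ltr01 divr_gt0 // mulr_gt0 // ltr_wpDl // mulr_ge0.
exists (Num.min 1 (d / (2 * (2 * `|z| + 1)))) => // t tpos.
rewrite le_min => /andP[t1 td].
have {}td : t * (2 * `|z|) < d.
  move: td; rewrite ler_pdivlMr ?mulr_gt0 ?ltr_wpDl ?mulr_ge0 // => td.
  have := mulr_ge0 (ltW tpos) (normr_ge0 z); lra.
set p := vbar + t *: z; set mu := r + 1.
have mu0 : 0 <= mu by rewrite addr_ge0.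
have pd : `|p| * d < eps0.
  apply: le_lt_trans dP; rewrite ler_wpM2r ?(ltW d0) //.
  apply: le_trans (ler_normD _ _) _; rewrite normrZ gtr0_norm //.
  have := ler_piMl (normr_ge0 z) t1; rewrite /P; lra.
have [x [xd fx x_min]] := tilted_minimum mu0 d0 deps deps0 pd.
have x_near : `|x - xbar| <= t * (2 * `|z|).
  have := x_min xbar; rewrite subrr normr0 dot0r expr0n mulr0 subrr sub0r => /(_ (ltW d0)).
  have := minor (le_trans xd deps).
  rewrite -(fineK fx) -(fineK fxbar) -!EFinD !lee_fin /p /mu dotDl dotZl => le1 le2.
  have := ler_wpM2l (ltW tpos) (le_trans (ler_norm _) (cauchy_schwarz dot_norm z (x - xbar))).
  have [->|x0] := eqVneq (x - xbar) 0; first by rewrite normr0 !mulr_ge0 // ltW.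
  (* |x - xbar|^2 / 2 <= t |z| |x - xbar|, to be divided by |x - xbar| *)
  have n0 : 0 < `|x - xbar| by rewrite normr_gt0.
  move=> le3; rewrite -(ler_pM2r n0); lra.
exists (t^-1 *: (x - xbar)).
  by rewrite normrZ gtr0_norm ?invr_gt0 // mulrC ler_pdivrMr // mulrC.
have tK : t *: (t^-1 *: (x - xbar)) = x - xbar by rewrite scalerA mulfV ?gt_eqF // scale1r.
have -> : xbar + t *: (t^-1 *: (x - xbar)) = x by rewrite tK addrC subrK.
have -> : vbar + t *: (z - mu *: (t^-1 *: (x - xbar))) = p - mu *: (x - xbar).
  by rewrite scalerBr scalerA mulrC -scalerA tK addrA.
apply: (@proximal_subdifferential _ _ mu (d - `|x - xbar|)) => //.
  by rewrite subr_gt0 (le_lt_trans x_near).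
move=> x' x'x; have x'd : `|x' - xbar| <= d.
  have -> : x' - xbar = (x' - x) + (x - xbar) by rewrite addrA subrK.
  by rewrite (le_trans (ler_normD _ _)) // -lerBrDr ltW.
have := x_min x' x'd; apply: le_trans; rewrite leeD2l // lee_fin.
have -> : x' - xbar = (x' - x) + (x - xbar) by rewrite addrA subrK.
rewrite -!(dot_normE dot_norm); move: (x' - x) (x - xbar) => s q.
rewrite !dotE (dotC q s); by rewrite le_eqVlt; apply/orP; left; apply/eqP; field.
Qed.

Lemma tangent_subdifferential_onto z : exists w e,
  tangent_cone (gph (subdifferential dot f)) (xbar, vbar) (w, e) /\ e + (r + 1) *: w = z.
Proof.
have [t0 t0_gt0 stepP] := subdifferential_step z.
have [N hN] : exists N : nat, harmonic N < t0.
  by have [N] := ltr_add_invr t0_gt0; rewrite add0r; exists N.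
have h0 k : 0 < harmonic (k + N)%N :> R by exact: harmonic_gt0.
have hle k : harmonic (k + N)%N <= t0.
  by apply: le_trans (ltW hN); rewrite lef_pV2 ?posrE // ler_nat ltnS leq_addl.
have /choice[w_ wP] k : exists w, `|w| <= 2 * `|z| /\
   subdifferential dot f (xbar + harmonic (k + N)%N *: w)
     (vbar + harmonic (k + N)%N *: (z - (r + 1) *: w)).
  by have [w wz ws] := stepP _ (h0 k) (hle k); exists w.
have [phi phioo [w ww]] := bounded_subseq dot_norm (fun k => (wP k).1).
exists w, (z - (r + 1) *: w); split; last by rewrite subrK.
apply/tangent_coneE; exists (fun k => harmonic (phi k + N)%N),
  (fun k => ((w_ \o phi) k, z - (r + 1) *: (w_ \o phi) k)); split.
- exact: cvg_comp phioo (cvg_tail (N := N) cvg_harmonic_right).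
- apply/cvg_prodP; split; first exact: ww.
  by apply: cvgB; [exact: cvg_cst | exact: cvgZl_tmp].
- by move=> k; exact: (wP _).2.
Qed.

End Surjectivity.

Theorem theorem3p10 (R : realType) (X : normedVectType R)
    (dot : {dot X for idfun}) (dot_norm : induces_norm dot)
    (f : X -> \bar R) (xbar vbar : X)
    (f_prox : prox_regular dot f xbar vbar)
    (f_cont : subdifferentially_continuous dot f xbar vbar)
    (f_proto :
       strictly_proto_differentiable (subdifferential dot f) xbar vbar) :
  let K := dom_second_subderivative dot f xbar vbar in
  [/\ exists U : {vspace X}, K = [set` U],
      exists A : {linear X -> X},
        represents_second_subderivative dot f xbar vbar A
    & forall A : {linear X -> X},
        represents_second_subderivative dot f xbar vbar A ->
        forall w : X,
          graphical_derivative (subdifferential dot f) xbar vbar w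
            = coderivative dot (subdifferential dot f) xbar vbar w /\
          coderivative dot (subdifferential dot f) xbar vbar w
            = [set A w + z | z in normal_cone dot K w]].
Proof.
move=> K; rewrite /strictly_proto_differentiable in f_proto.
have [fxbar [eps0 eps0_gt0 lsc] vbar_sub [eps [r [eps_gt0 r_ge0 prox]]]] := f_prox.
set G := gph (subdifferential dot f) in f_proto *.
have Gp : G (xbar, vbar) by [].
pose L := regular_tangent_cone G (xbar, vbar).
have L_linear : linear_set L := regular_tangent_cone_linear f_proto.
have TL : tangent_cone G (xbar, vbar) = L := tangent_cone_strict Gp f_proto.
have L_reach (t_ : nat -> R) : (forall k, 0 < t_ k) -> t_ @ \oo --> (0 : R) ->
    forall w e, L (w, e) -> exists w_ e_, graph_seq (dot := dot) f xbar vbar t_ w e w_ e_.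
  move=> t0 tt w e Lwe.
  have [u /cvg_prodP[u1 u2] uG] := regular_tangent_seq Gp Lwe t0 tt.
  by exists (fst \o u), (snd \o u); split.
have h0 k : 0 < harmonic k :> R by exact: harmonic_gt0.
have L_iso w e u z : L (w, e) -> L (u, z) -> dot e u = dot z w.
  exact: (graph_isotropic dot_norm eps_gt0 r_ge0 vbar_sub f_cont prox h0 cvg_harmonic
    L_linear (L_reach _ h0 cvg_harmonic)).
have L_onto z : exists w e, L (w, e) /\ e + (r + 1) *: w = z.
  rewrite -TL; apply: (tangent_subdifferential_onto dot_norm eps_gt0 eps0_gt0 r_ge0 fxbar lsc).
  exact: (prox_at_base eps_gt0 vbar_sub prox).
have L_max := lagrangian_maximal L_iso L_onto.
have d2_graph w e : L (w, e) -> second_subderivative dot f xbar vbar w = (dot e w)%:E.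
  exact: (second_subderivative_graph dot_norm eps_gt0 r_ge0 vbar_sub f_cont prox
    L_linear L_reach).
have KE : K = rel_dom L.
  apply/seteqP; split=> w; rewrite /K /dom_second_subderivative /=; last first.
    by move=> [e Lwe]; rewrite (d2_graph _ _ Lwe) ltey.
  apply: contraPP => Lw; rewrite (second_subderivative_off_dom dot_norm eps_gt0 r_ge0
    vbar_sub f_cont prox L_linear L_reach _ Lw) ?ltxx //.
  exact: rel_dom_orthogonal L_iso L_onto.
have K_linear : linear_set K by rewrite KE; exact: rel_dom_linear.
split.
- exact: linear_set_vspace.
- have [A [A_sym A_repr]] := lagrangian_representative L_linear L_iso.
  exists A; split=> // w; rewrite -/K /indicator_function; case: asboolP.
    by rewrite KE => -[e Lwe]; rewrite adde0 (A_repr _ _ Lwe) (d2_graph _ _ Lwe).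
  rewrite /K /dom_second_subderivative /= => /negP; rewrite -leNgt leye_eq => /eqP ->.
  by rewrite addey.
move=> A [A_sym A_repr] w.
have A_graph u e : L (u, e) -> dot (A u) u = dot e u.
  move=> Lue; have Ku : K u by rewrite KE; exists e.
  have := A_repr u; rewrite -/K /indicator_function; case: asboolP => // _.
  by rewrite adde0 (d2_graph _ _ Lue) => -[->].
have L_graph := lagrangian_graph L_linear L_iso L_onto A_sym (linearD A) A_graph.
have coderivE : coderivative dot (subdifferential dot f) xbar vbar w = [set e | L (w, e)].
  apply/seteqP; split=> e;
    rewrite /coderivative /= (normal_cone_strict (bounded_subseq_prod dot_norm)
      (cvg_prod_dot dot_norm) Gp f_proto) -/L.
    move=> eN; apply: L_max => u z Luz; apply/eqP; rewrite eq_le; apply/andP.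
    have := eN _ Luz; have := eN _ (linear_setN L_linear Luz).
    by rewrite /prod_dot /= !dotE (dotC w z); split; lra.
  move=> Lwe [u z] Luz.
  by rewrite /prod_dot /= dotNl (L_iso _ _ _ _ Lwe Luz) (dotC w z) subrr.
rewrite coderivE /graphical_derivative TL; split=> //.
rewrite normal_cone_linear_set //; apply/seteqP; split=> e /=.
  move=> /L_graph[Kw eA]; rewrite KE; exists (e - A w) => //.
  by rewrite addrC subrK.
move=> [z [Kw zK] <-]; apply/L_graph; rewrite -KE; split=> // y Ky.
by rewrite addrC addKr zK.
Qed.
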